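(* Let $K$ be a compact subset of $\mathbb R$ and $n\in\mathbb N$. Suppose that there are $r\ge1$ and $\gamma\ge 1$ such that for all $m,k\in\mathbb N$ with $k\ge m$ there are $c>0$ and $\varepsilon_k>0$ such that for all $\varepsilon\in(0,\varepsilon_k)$ and all $x\in K$: whenever $(x-\varepsilon^r,x+\varepsilon^r)$ contains strictly more than $n+1$ points of $K$, there are distinct points $y_0,\dots,y_k\in K\cap(x-\varepsilon,x+\varepsilon)$ with $$\frac{\sup_{0\le i,\nu\le k}|y_i-y_\nu|^{k-m}}{\inf_{i\ne\nu}|y_i-y_\nu|^k}\le\frac{c}{\varepsilon^{\gamma m}}.$$ Then $K$ has the smooth extension property.
   Context: For compact $K\subseteq\mathbb R$ let $C^\infty(K)=\{F|_K: F\in C^\infty(\mathbb R)\}$, endowed with the quotient topology of the Fréchet space $C^\infty(\mathbb R)$ (smooth functions with uniform convergence of all derivatives on compact sets) under the restriction map $F\mapsto F|_K$. $K$ has the smooth extension property if there is a continuous linear operator $E:C^\infty(K)\to C^\infty(\mathbb R)$ with $E(f)|_K=f$ for all $f\in C^\infty(K)$. Convention: $0^0=1$. *)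

(* Defs.v *)
From HB Require Import structures.
From mathcomp Require Import all_boot all_order all_algebra.
From mathcomp Require Import all_classical all_reals all_analysis.

Set Implicit Arguments.
Unset Strict Implicit.
Unset Printing Implicit Defensive.

Import Order.TTheory GRing.Theory Num.Theory.
Import numFieldNormedType.Exports.

Local Open Scope classical_set_scope.
Local Open Scope ring_scope.

Definition is_smooth (R : realType) : {pred R -> R} :=
  fun f => `[< forall (j : nat) (x : R), derivable (derive1n j f) x 1 >].
Arguments is_smooth : clear implicits.

Lemma is_smoothP (R : realType) (f : R -> R) :
  reflect (forall (j : nat) (x : R), derivable (derive1n j f) x 1) (f \in is_smooth R).
Proof. exact: asboolP. Qed.

Lemma derive1n_linear (R : realType) (a : R) (f g : R -> R) (j : nat) :
  f \in is_smooth R -> g \in is_smooth R ->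
  derive1n j (a *: f + g) = a *: derive1n j f + derive1n j g.
Proof.
move=> /is_smoothP sf /is_smoothP sg; elim: j => [//|j IHj].
rewrite !derive1nS IHj; apply/funext => x.
rewrite derive1E deriveD; [|exact/derivableZ/sf|exact: sg].
by rewrite deriveZ; [rewrite -!derive1E|exact: sf].
Qed.

Lemma is_smooth_submod (R : realType) : submod_closed (is_smooth R).
Proof.
split=> [|a f g sf sg]; apply/is_smoothP => j x.
  suff -> : derive1n j (0 : R -> R) = cst 0 by exact: derivable_cst.
  elim: j => [//|j IHj]; rewrite derive1nS IHj.
  by apply/funext => y; rewrite derive1_cst.
rewrite derive1n_linear//.
by apply: derivableD; [apply: derivableZ|]; apply/is_smoothP.
Qed.

HB.instance Definition _ (R : realType) :=
  GRing.isSubmodClosed.Build R (R -> R) (is_smooth R) (@is_smooth_submod R).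

Record smooth (R : realType) := Smooth {
  smooth_fun :> R -> R;
  smooth_funP : smooth_fun \in is_smooth R }.

HB.instance Definition _ (R : realType) := [isSub for @smooth_fun R].
HB.instance Definition _ (R : realType) := [Choice of smooth R by <:].
HB.instance Definition _ (R : realType) :=
  [SubChoice_isSubLmodule of smooth R by <:].

(* The Frechet topology of the smooth functions is the initial topology of the
   map sending f to the sequence of its derivatives, each derivative being
   taken in the space of functions with compact convergence. *)
Definition derivatives (R : realType) (f : smooth R) :
    prod_topology (fun _ : nat => {family compact, R -> R}) :=
  fun j => derive1n j f.

HB.instance Definition _ (R : realType) :=
  Topological.copy (smooth R) (initial_topology (@derivatives R)).

Definition has_smooth_extension (R : realType) (K : set R) : {pred K -> R} :=
  fun g => `[< exists F : smooth R, sigL K F = g >].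
Arguments has_smooth_extension {R} K.

Lemma has_smooth_extension_submod (R : realType) (K : set R) :
  submod_closed (has_smooth_extension K).
Proof.
split=> [|a f g /asboolP[F <-] /asboolP[G <-]]; apply/asboolP.
  by exists 0.
by exists (a *: F + G).
Qed.

HB.instance Definition _ (R : realType) (K : set R) :=
  GRing.isSubmodClosed.Build R (K -> R) (has_smooth_extension K)
    (@has_smooth_extension_submod R K).

Record smooth_on (R : realType) (K : set R) := SmoothOn {
  smooth_on_fun :> K -> R;
  smooth_on_funP : smooth_on_fun \in has_smooth_extension K }.

HB.instance Definition _ (R : realType) (K : set R) :=
  [isSub for @smooth_on_fun R K].
HB.instance Definition _ (R : realType) (K : set R) :=
  [Choice of smooth_on K by <:].
HB.instance Definition _ (R : realType) (K : set R) :=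
  [SubChoice_isSubLmodule of smooth_on K by <:].

Lemma restr_subproof (R : realType) (K : set R) (F : smooth R) :
  sigL K F \in has_smooth_extension K.
Proof. by apply/asboolP; exists F. Qed.

Definition restr (R : realType) (K : set R) (F : smooth R) : smooth_on K :=
  SmoothOn (restr_subproof K F).

(* Quotient topology under the surjection restr K : smooth R -> smooth_on K. *)
Definition smooth_on_open (R : realType) (K : set R) : set_system (smooth_on K) :=
  fun U => open (@restr R K @^-1` U).

Section smooth_on_topology.
Variables (R : realType) (K : set R).

Let openTK : @smooth_on_open R K setT.
Proof. by rewrite /smooth_on_open preimage_setT; exact: openT. Qed.

Let openIK : setI_closed (@smooth_on_open R K).
Proof. by move=> U V; exact: openI. Qed.

Let open_bigcupK (I : Type) (U : I -> set (smooth_on K)) :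
  (forall i, smooth_on_open (U i)) -> smooth_on_open (\bigcup_i U i).
Proof. by move=> oU; apply: bigcup_open => i _; exact: oU. Qed.

HB.instance Definition _ :=
  isOpenTopological.Build (smooth_on K) openTK openIK open_bigcupK.

End smooth_on_topology.

Definition smooth_extension_property (R : realType) (K : set R) :=
  exists E : {linear smooth_on K -> smooth R},
    continuous E /\ forall f : smooth_on K, restr K (E f) = f.

(* Main.v *)
(* Call [x] in [K] crowded at scale [s] if [K] has more than [n+1] points within
   [2^(-q s)] of [x].  At a crowded point the hypothesis, used with [m = i] at the
   larger scale [e_i = 2^(-s/(i+1))], provides nodes whose Lagrange polynomial has
   an [i]-th derivative that estimates [F^(i)] at a node [z_i] within [e_i] of [x],
   with a norm at most [2^(g s)] for all [i] at once.  Let [P] be the polynomial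
   with these derivatives at the [z_i], [i <= k].  Integrating down from the order
   [M] to the order [j], the error [F - P] picks up the factor [e_j ... e_(M-1)],
   which is [2^(-s (1/(j+1) + ... + 1/M))]; as the harmonic series diverges, [P]
   approximates each derivative of [F] to every order in [2^(-s)], with seminorms
   of [F] that do not depend on [k], provided [k] grows slowly with [s].
   The operator is a sum over the scales.  On a grid finer than the scale, glue by
   a partition of unity the differences of the local polynomials of successive
   scales near crowded points.  Where the crowded points disappear, [K] has at most
   [n+1] points locally, and the remaining error is interpolated there; by Rolle
   this interpolation is bounded by derivatives of the error of order at most [n].
   On [K] the sum telescopes to [F]. *)

Require Import Defs.
From HB Require Import structures.
From mathcomp Require Import all_boot all_order all_algebra.
From mathcomp Require Import all_classical all_reals all_analysis.
From mathcomp Require Import finmap zify ring lra.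

Set Implicit Arguments.
Unset Strict Implicit.
Unset Printing Implicit Defensive.

Import Order.TTheory GRing.Theory Num.Theory.
Import numFieldNormedType.Exports.

Local Open Scope classical_set_scope.
Local Open Scope card_scope.
Local Open Scope ring_scope.

(** * Smooth functions *)

(* A rigid wrapper: unification would otherwise unfold the classical boolean
   behind [is_smooth], at a prohibitive cost. *)
Variant smoothf (R : realType) (f : R -> R) : Prop := Smoothf of f \in is_smooth R.

Lemma smoothfP (R : realType) (f : R -> R) :
  smoothf f <-> forall (j : nat) (x : R), derivable (derive1n j f) x 1.
Proof. by split=> [[/is_smoothP//]|/is_smoothP]. Qed.

Lemma smooth_derivable (R : realType) (f : R -> R) (j : nat) (x : R) :
  smoothf f -> derivable (derive1n j f) x 1.
Proof. by move=> /smoothfP; exact. Qed.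

Lemma smooth_is_derive (R : realType) (f : R -> R) (j : nat) (x : R) :
  smoothf f -> is_derive x 1 (derive1n j f) (derive1n j.+1 f x).
Proof.
by move=> sf; rewrite derive1nS derive1E; apply: derivableP; exact: smooth_derivable.
Qed.

Lemma smooth_continuous (R : realType) (f : R -> R) (j : nat) :
  smoothf f -> continuous (derive1n j f).
Proof.
by move=> sf x; apply/differentiable_continuous/derivable1_diffP/smooth_derivable.
Qed.

Lemma derive1n_add (R : realType) (f : R -> R) (i j : nat) :
  derive1n j (derive1n i f) = derive1n (j + i) f.
Proof. by rewrite /derive1n -iterD. Qed.

Lemma smooth_derive1n (R : realType) (f : R -> R) (i : nat) :
  smoothf f -> smoothf (derive1n i f).
Proof.
move=> /smoothfP sf; apply/smoothfP => j x.
by rewrite derive1n_add; exact: sf.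
Qed.

(** Closure under products and inverses goes by induction on a finite order: the derivative of such
    a function involves its ingredients only up to orders already reached. *)
Definition diffn (R : realType) (j : nat) (f : R -> R) :=
  forall (i : nat) (x : R), (i < j)%N -> derivable (derive1n i f) x 1.

Lemma diffn_smooth (R : realType) (f : R -> R) :
  (forall j, diffn j f) -> smoothf f.
Proof. by move=> df; apply/smoothfP => j x; exact: (df j.+1). Qed.

Lemma smooth_diffn (R : realType) (f : R -> R) (j : nat) :
  smoothf f -> diffn j f.
Proof. by move=> sf i x _; exact: smooth_derivable. Qed.

Lemma diffnS (R : realType) (j : nat) (f : R -> R) :
  diffn j.+1 f <-> (forall x : R, derivable f x 1) /\ diffn j (derive1 f).
Proof.
split=> [df|[df df'] [|i] x ij]; last 2 first.
- exact: df.
- by rewrite derive1Sn; exact: df'.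
split=> [x|i x ij]; first exact: (df 0).
by rewrite -derive1Sn; exact: df.
Qed.

Lemma diffn0 (R : realType) (f : R -> R) : diffn 0 f.
Proof. by move=> i x; rewrite ltn0. Qed.

Lemma diffnW (R : realType) (j : nat) (f : R -> R) : diffn j.+1 f -> diffn j f.
Proof. by move=> df i x ij; apply: df; exact: ltnW. Qed.

Lemma diffnD (R : realType) (j : nat) (f g : R -> R) :
  diffn j f -> diffn j g -> diffn j (f + g).
Proof.
elim: j f g => [f g _ _|j IHj f g /diffnS[df df'] /diffnS[dg dg']]; first exact: diffn0.
apply/diffnS; split=> [x|]; first exact: derivableD.
have -> : derive1 (f + g) = derive1 f + derive1 g; last exact: (IHj _ _ df' dg').
by apply/funext => x; rewrite derive1E deriveD// -!derive1E.
Qed.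

Lemma diffnM (R : realType) (j : nat) (f g : R -> R) :
  diffn j f -> diffn j g -> diffn j (f * g).
Proof.
elim: j f g => [f g _ _|j IHj f g df dg]; first exact: diffn0.
have [/diffnS[f1 f'] /diffnS[g1 g']] := (df, dg).
apply/diffnS; split=> [x|]; first exact: derivableM.
have -> : derive1 (f * g) = derive1 f * g + f * derive1 g.
  apply/funext => x; rewrite derive1E deriveM//.
  by rewrite -!derive1E addrC [g x *: _]mulrC.
apply: diffnD; apply: IHj; [exact: f'|exact: diffnW|exact: diffnW|exact: g'].
Qed.

Lemma smoothM (R : realType) (f g : R -> R) :
  smoothf f -> smoothf g -> smoothf (f * g).
Proof.
by move=> sf sg; apply: diffn_smooth => j; apply: diffnM; exact: smooth_diffn.
Qed.

Lemma derive1M (R : realType) (f g : R -> R) :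
  smoothf f -> smoothf g ->
  derive1 (f * g) = derive1 f * g + f * derive1 g.
Proof.
move=> sf sg; apply/funext => x.
rewrite derive1E deriveM; [|exact: (@smooth_derivable _ _ 0)..].
by rewrite -!derive1E addrC [g x *: _]mulrC.
Qed.

Lemma smoothD (R : realType) (f g : R -> R) :
  smoothf f -> smoothf g -> smoothf (f + g).
Proof. by move=> [sf] [sg]; split; exact: (rpredD sf sg). Qed.

Lemma smoothB (R : realType) (f g : R -> R) :
  smoothf f -> smoothf g -> smoothf (f - g).
Proof. by move=> [sf] [sg]; split; exact: (rpredB sf sg). Qed.

Lemma smooth_sum (R : realType) (I : Type) (r : seq I) (P : pred I)
    (F : I -> R -> R) :
  (forall i, P i -> smoothf (F i)) -> smoothf (\sum_(i <- r | P i) F i).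
Proof. by move=> sF; split; apply: rpred_sum => i /sF[]. Qed.

Lemma derive1nD (R : realType) (f g : R -> R) (j : nat) :
  smoothf f -> smoothf g ->
  derive1n j (f + g) = derive1n j f + derive1n j g.
Proof. by move=> [sf] [sg]; rewrite -[f in LHS]scale1r derive1n_linear// scale1r. Qed.

Lemma derive1nB (R : realType) (f g : R -> R) (j : nat) :
  smoothf f -> smoothf g ->
  derive1n j (f - g) = derive1n j f - derive1n j g.
Proof.
by move=> [sf] [sg]; rewrite addrC -scaleN1r derive1n_linear// scaleN1r addrC.
Qed.

Lemma derive1n_sum (R : realType) (I : Type) (r : seq I) (P : pred I)
    (F : I -> R -> R) (j : nat) :
  (forall i, P i -> smoothf (F i)) ->
  derive1n j (\sum_(i <- r | P i) F i) = \sum_(i <- r | P i) derive1n j (F i).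
Proof.
move=> sF; elim: r => [|i r IHr].
  rewrite !big_nil; elim: j => [//|j IHj]; rewrite derive1nS IHj.
  by apply/funext => x; rewrite derive1_cst.
rewrite !big_cons; case: ifP => [Pi|//].
by rewrite derive1nD ?IHr//; [exact: sF|exact: smooth_sum].
Qed.

(** One differentiation splits a product into two of the same kind, so [j] of them give [2 ^+ j]
    products; no binomial coefficients are needed. *)
Lemma derive1nM_bound (R : realType) (f g : R -> R) (x B C : R) (j : nat) :
  smoothf f -> smoothf g ->
  (forall i, (i <= j)%N -> `|derive1n i f x| <= B) ->
  (forall i, (i <= j)%N -> `|derive1n i g x| <= C) ->
  `|derive1n j (f * g) x| <= 2 ^+ j * (B * C).
Proof.
elim: j f g => [|j IHj] f g sf sg hf hg.
  rewrite mul1r [derive1n _ _ _]/= [(f * g) x]/GRing.mul /= normrM.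
  by apply: ler_pM => //; [exact: (hf 0)|exact: (hg 0)].
have sf' := @smooth_derive1n _ _ 1 sf; have sg' := @smooth_derive1n _ _ 1 sg.
rewrite derive1Sn (derive1M sf sg).
rewrite (derive1nD _ (smoothM sf' sg) (smoothM sf sg')).
rewrite exprS -mulrA mulr_natl mulr2n (le_trans (ler_normD _ _))//.
have lt i : (i <= j)%N -> (i.+1 <= j.+1)%N by [].
have lw i : (i <= j)%N -> (i <= j.+1)%N by move=> ij; exact: leqW.
apply: lerD; apply: IHj.
- exact: sf'.
- exact: sg.
- by move=> i /lt /hf; rewrite derive1Sn.
- by move=> i /lw /hg.
- exact: sf.
- exact: sg'.
- by move=> i /lw /hf.
- by move=> i /lt /hg; rewrite derive1Sn.
Qed.

Lemma smooth_cst (R : realType) (c : R) : smoothf (cst c : R -> R).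
Proof.
apply/smoothfP => -[|j] x; first exact: derivable_cst.
rewrite derive1Sn; suff -> : derive1n j (derive1 (cst c)) = cst (0 : R) :> (R -> R).
  exact: derivable_cst.
by elim: j => [|j IHj]; rewrite ?derive1nS ?IHj; apply/funext => y /=; rewrite derive1_cst.
Qed.

Lemma derive1n_horner (R : realType) (p : {poly R}) (j : nat) :
  derive1n j (horner p) = horner p^`(j).
Proof.
by elim: j => [|j IHj]; rewrite ?derivn0// derive1nS IHj derivnS derivE.
Qed.

Lemma smooth_horner (R : realType) (p : {poly R}) : smoothf (horner p).
Proof. by apply/smoothfP => j x; rewrite derive1n_horner; exact: derivable_horner. Qed.

Lemma affineE (R : realType) (a b : R) :
  (fun y : R => a * y + b) = horner (a *: 'X + b%:P).
Proof. by apply/funext => y; rewrite !hornerE. Qed.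

Lemma derive1n_affine (R : realType) (f : R -> R) (a b : R) (j : nat) :
  smoothf f ->
  derive1n j (fun x => f (a * x + b)) = (fun x => a ^+ j * derive1n j f (a * x + b)).
Proof.
move=> sf; elim: j => [|j IHj]; first by apply/funext => x; rewrite mul1r.
rewrite derive1nS IHj; apply/funext => x.
have d1 : is_derive x (1 : R) (fun y : R => a * y + b) a.
  rewrite affineE; apply: is_derive_eq.
  by rewrite derivD derivC derivZ derivX addr0 hornerZ hornerC mulr1.
have dg : derivable (fun y : R => a * y + b) x 1 by exact: ex_derive.
have df y := @smooth_derivable R f j y sf.
rewrite derive1Ml; last first.
  by apply/derivable1_diffP/(@differentiable_comp _ _ _ _ _ (derive1n j f));
    apply/derivable1_diffP.
rewrite (derive1_comp dg (df _)) -derive1nS [X in _ * (_ * X)]derive1E derive_val.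
by rewrite exprS; ring.
Qed.

Lemma smooth_affine (R : realType) (f : R -> R) (a b : R) :
  smoothf f -> smoothf (fun x => f (a * x + b)).
Proof.
move=> sf; apply: diffn_smooth => j; elim: j f sf => [f _|j IHj f sf]; first exact: diffn0.
apply/diffnS; split=> [x|].
  apply/derivable1_diffP/(@differentiable_comp _ _ _ _ (fun y : R => a * y + b) f);
    apply/derivable1_diffP; last exact: (@smooth_derivable _ _ 0).
  by rewrite affineE; exact: derivable_horner.
have -> : derive1 (fun x => f (a * x + b)) =
    cst a * (fun x => derive1n 1 f (a * x + b)).
  exact: (@derive1n_affine _ f a b 1 sf).
apply: diffnM; first exact/smooth_diffn/smooth_cst.
exact/IHj/smooth_derive1n.
Qed.

(** The derivative of [1/f] is [-f' (1/f)^2], so one more order for [1/f] needs [1/f] only to the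
    order that the induction already has. *)
Lemma smoothV (R : realType) (f : R -> R) :
  smoothf f -> (forall x, f x != 0) -> smoothf (fun x => (f x)^-1).
Proof.
move=> sf f0; apply: diffn_smooth; elim=> [|j IHj]; first exact: diffn0.
apply/diffnS; split=> [x|]; first exact/(derivableV (f0 x))/(@smooth_derivable _ _ 0).
have -> : derive1 (fun x => (f x)^-1) =
    cst (-1) * derive1 f * ((fun x => (f x)^-1) * (fun x => (f x)^-1)).
  apply/funext => x; rewrite derive1E deriveV//; last exact: (@smooth_derivable _ _ 0).
  rewrite -derive1E /GRing.mul/= -exprVn.
  by rewrite /GRing.scale/= expr2 mulN1r !mulNr mulrC.
apply: diffnM; last by apply: diffnM; exact: IHj.
by apply: diffnM; apply: smooth_diffn; [exact: smooth_cst|exact: (@smooth_derive1n _ _ 1)].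
Qed.

Lemma smooth_mvt (R : realType) (f : R -> R) (a b : R) :
  smoothf f -> a <= b ->
  exists2 c, a <= c <= b & f b - f a = derive1 f c * (b - a).
Proof.
move=> sf ab; have [x _|x|c] := @MVT_segment R f (derive1 f) a b ab.
- exact: (@smooth_is_derive _ _ 0).
- by apply: continuous_subspaceT => y; exact: (@smooth_continuous _ _ 0).
by rewrite in_itv/= => cab fE; exists c.
Qed.

Lemma mvt_ball (R : realType) (f : R -> R) (x e B y z : R) :
  smoothf f -> (forall w, `|w - x| <= e -> `|derive1 f w| <= B) ->
  `|y - x| <= e -> `|z - x| <= e -> `|f y| <= `|f z| + `|y - z| * B.
Proof.
move=> sf fB ye ze.
suff : `|f y - f z| <= `|y - z| * B.
  by move=> h; rewrite -lerBlDl (le_trans (lerB_dist _ _)).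
wlog yz : y z ye ze / z <= y.
  move=> H; have [|/ltW] := leP z y; first exact: H.
  by rewrite distrC [ `|y - z|]distrC; exact: H.
have [c cyz ->] := smooth_mvt sf yz.
rewrite normrM mulrC ler_wpM2l//; apply: fB.
move: ye ze cyz; rewrite !ler_norml => /andP[? ?] /andP[? ?] /andP[? ?].
by apply/andP; split; lra.
Qed.

(* Each derivative is recovered from its value at one point and from the next
   derivative, at the cost of the length of the interval. *)
Lemma derivative_chain (R : realType) (f : R -> R) (x d D : R) (e z : nat -> R)
    (j m : nat) :
  smoothf f -> 0 <= d -> 0 <= D -> (j <= m)%N ->
  (forall i, 0 <= e i <= 1) -> (forall i, e i <= e i.+1) ->
  (forall i, (j <= i < m)%N -> `|z i - x| <= e i /\ `|derive1n i f (z i)| <= d) ->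
  (forall y, `|y - x| <= e m -> `|derive1n m f y| <= D) ->
  forall y, `|y - x| <= e j ->
  `|derive1n j f y| <= 4 ^+ (m - j) * (d + \prod_(j <= i < m) e i * D).
Proof.
move=> sf d0 D0 jm e01 eS; 
have [k ->] : exists k, m = (k + j)%N by exists (m - j)%N; rewrite subnK.
rewrite addnK; elim: k j {jm} => [|k IHk] j zi fD y yj.
  by rewrite add0n big_geq// !mul1r; have := fD _ yj; rewrite add0n; lra.
have e2 : 0 <= e j <= 1 := e01 j.
have jk : (j <= j < k.+1 + j)%N by lia.
have [zje zjd] := zi j jk.
have H : `|derive1n j f y| <= `|derive1n j f (z j)| +
    `|y - z j| * (4 ^+ k * (d + \prod_(j.+1 <= i < k + j.+1) e i * D)).
  apply: (@mvt_ball _ _ x (e j)); [exact: smooth_derive1n| |exact: yj|exact: zje].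
  move=> w we; rewrite -derive1nS; apply: IHk.
  - by move=> i /andP[ji ik]; apply: zi; rewrite (ltnW ji) addSn -addnS.
  - by move=> v; rewrite addnS; exact: fD.
  - exact: le_trans (eS j).
set p := \prod_(_ <= _ < _) _ in H *.
have -> : \prod_(j <= i < k.+1 + j) e i = e j * p.
  by rewrite addSn -addnS big_ltn// addnS ltnS leq_addl.
have p0 : 0 <= p by apply: prodr_ge0 => i _; case/andP: (e01 i).
have yz : `|y - z j| <= 2 * e j.
  by rewrite -(subrKA x) (le_trans (ler_normD _ _))// [ `|x - _|]distrC; lra.
have q1 : 1 <= 4 ^+ k :> R by rewrite exprn_ege1//; lra.
have pD0 : 0 <= p * D by exact: mulr_ge0.
(* The 2 is the distance from [y] to [z j] in units of [e j]; the base 4 leaves room for the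
   additional [d]. *)
apply: (le_trans H); apply: (@le_trans _ _ (d + 2 * e j * (4 ^+ k * (d + p * D)))).
  by apply: lerD => //; apply: ler_wpM2r => //; apply: mulr_ge0; lra.
rewrite exprS; set q := 4 ^+ k in q1 *.
have -> : 2 * e j * (q * (d + p * D)) = 2 * (e j * (q * d)) + 2 * (q * (e j * p * D)) by ring.
have -> : 4 * q * (d + e j * p * D) = 4 * (q * d) + 4 * (q * (e j * p * D)) by ring.
have qd : d <= q * d by rewrite ler_peMl.
have h1 : e j * (q * d) <= q * d by rewrite ler_piMl//; lra.
have h2 : 0 <= q * (e j * p * D).
  by apply: mulr_ge0; [lra|rewrite -mulrA mulr_ge0//; lra].
lra.
Qed.

(** Each gap between consecutive zeros gives a zero of the derivative. The head [x] is kept apart so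
    that the sizes match, and the bounds by [x] and [last x s] keep the new zeros ordered in the
    induction. *)
Lemma rolle_seq (R : realType) (f : R -> R) (x : R) (s : seq R) :
  smoothf f -> f x = 0 -> path <%R x s -> (forall y, y \in s -> f y = 0) ->
  exists t : seq R, [/\ size t = size s, sorted <%R t,
    forall y, y \in t -> derive1 f y = 0 &
    forall y, y \in t -> x < y < last x s].
Proof.
move=> sf; elim: s x => [|a s IHs] x fx; first by exists [::].
move=> /= /andP[xa pas] fs.
have fa : f a = 0 by apply: fs; rewrite mem_head.
have [|t [tsz tsrt tf tb]] := IHs a fa pas.
  by move=> y ys; apply: fs; rewrite inE ys orbT.
have [c cxa fc] : exists2 c, x < c < a & derive1 f c = 0.
  have [y _||//|c] := @Rolle R f x a xa.
  - exact: (@smooth_derivable _ _ 0).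
  - by apply: continuous_subspaceT => y; exact: (@smooth_continuous _ _ 0).
  - by rewrite fx fa.
  - by rewrite in_itv/= => cxa fc; exists c => //; rewrite derive1E derive_val.
have al : a <= last a s.
  have /allP : all (>= a) (a :: s).
    move: pas; rewrite lt_path_sortedE => /andP[/allP as_ _].
    by apply/allP => y; rewrite inE => /predU1P[->//|/as_ /ltW].
  by apply; exact: mem_last.
exists (c :: t); split.
- by rewrite /= tsz.
- rewrite /= path_min_sorted//; apply/allP => y /tb /andP[ay _].
  by move: cxa => /andP[_ ca]; exact: lt_trans ca ay.
- by move=> y; rewrite inE => /predU1P[->//|/tf].
- move=> y; rewrite inE => /predU1P[->|/tb /andP[ay ->]].
    by case/andP: cxa => -> ca; rewrite /= (lt_le_trans ca).
  by rewrite andbT (lt_trans xa).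
Qed.

(** Every derivative costs one zero, so more than [i] zeros leave at least one at order [i]. *)
Lemma rolle_iter (R : realType) (f : R -> R) (s : seq R) (a b : R) (i : nat) :
  smoothf f -> sorted <%R s -> (forall y, y \in s -> f y = 0 /\ a <= y <= b) ->
  (i < size s)%N -> exists2 z, a <= z <= b & derive1n i f z = 0.
Proof.
elim: i f s => [|i IHi] f [//|x s] sf srt fs.
  by move=> _; have [fx xab] := fs x (mem_head _ _); exists x.
move=> /= sz; have [fx xab] := fs x (mem_head _ _).
have [y ys|t [tsz tsrt tf tb]] := rolle_seq sf fx srt.
  by apply: (fs y _).1; rewrite inE ys orbT.
have [] := IHi (derive1 f) t.
- exact: (@smooth_derive1n _ _ 1).
- exact: tsrt.
- move=> y yt; split; first exact: tf.
  have /andP[xy yl] := tb y yt.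
  have [_ /andP[_ lb]] := fs _ (mem_last x s).
  by case/andP: xab => ax _; rewrite (le_trans ax (ltW xy)) (le_trans (ltW yl) lb).
- by rewrite tsz; lia.
by move=> z zab zf; exists z; [exact: zab|rewrite -derive1nS derive1Sn; exact: zf].
Qed.

Definition taylor (R : realType) (f : R -> R) (a : R) (m : nat) : {poly R} :=
  \sum_(i < m) (derive1n i f a / i`!%:R) *: ('X - a%:P) ^+ i.

Lemma derivn_XsubC_exp (R : realType) (a : R) (i j : nat) :
  ((('X - a%:P) ^+ i)^`(j)).[a] = (i == j)%:R * i`!%:R.
Proof.
elim: j i => [|j IHj] [|i].
- by rewrite derivn0 expr0 hornerC fact0 mulr1.
- by rewrite derivn0 exprS hornerM hornerXsubC subrr !mul0r.
- by rewrite derivSn expr0 derivC derivn_poly0 ?size_poly0// horner0 mul0r.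
rewrite derivSn deriv_exp derivB derivX derivC subr0 mul1r/=.
by rewrite derivnMn hornerMn IHj eqSS -mulrnAr; congr (_ * _); rewrite factS natrM mulr_natl.
Qed.

Lemma taylor_derivn (R : realType) (f : R -> R) (a : R) (m j : nat) :
  (j < m)%N -> ((taylor f a m)^`(j)).[a] = derive1n j f a.
Proof.
move=> jm; rewrite /taylor linear_sum horner_sum (bigD1 (Ordinal jm))//=.
rewrite derivnZ hornerZ derivn_XsubC_exp eqxx mul1r divfK; last first.
  by rewrite pnatr_eq0 -lt0n fact_gt0.
rewrite big1 ?addr0// => i /eqP ij; rewrite derivnZ hornerZ derivn_XsubC_exp.
case: eqP => [e|_]; last by rewrite mul0r mulr0.
by case: ij; apply: val_inj.
Qed.

Lemma size_taylor (R : realType) (f : R -> R) (a : R) (m : nat) :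
  (size (taylor f a m) <= m)%N.
Proof.
apply: (leq_trans (size_sum _ _ _)); apply/bigmax_leqP => i _.
by rewrite (leq_trans (size_scale_leq _ _))// size_exp_XsubC.
Qed.

(** The remainder and its derivatives below order [m] vanish at [a], so each of the [m] mean value
    steps from order [m] down to 0 gains a factor [e]. The factorial of the sharp remainder is given
    up. *)
Lemma taylor_bound (R : realType) (f : R -> R) (a e B y : R) (m : nat) :
  smoothf f -> (forall w, `|w - a| <= e -> `|derive1n m f w| <= B) ->
  `|y - a| <= e -> `|f y - (taylor f a m).[y]| <= e ^+ m * B.
Proof.
move=> sf fB ye; pose g := f - horner (taylor f a m).
have sg : smoothf g by apply: smoothB => //; exact: smooth_horner.
have gE i w : derive1n i g w = derive1n i f w - ((taylor f a m)^`(i)).[w].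
  by rewrite derive1nB// ?derive1n_horner//; exact: smooth_horner.
have e0 : 0 <= e by exact: le_trans ye.
suff /(_ m 0 (addn0 _) y ye) : forall k j, (k + j = m)%N ->
    forall y, `|y - a| <= e -> `|derive1n j g y| <= e ^+ k * B by [].
elim=> [|k IHk] j kj w we.
  have jm : j = m by rewrite -kj add0n.
  rewrite mul1r jm gE (derivn_poly0 (size_taylor _ _ _)) horner0 subr0; exact: fB.
have a0 : derive1n j g a = 0 by rewrite gE taylor_derivn ?subrr//; lia.
have := @mvt_ball R (derive1n j g) a e (e ^+ k * B) w a.
rewrite a0 normr0 add0r exprS -mulrA => H; apply: le_trans (H _ _ we _) _.
- exact: smooth_derive1n.
- by move=> v ve; rewrite -derive1nS; apply: IHk => //; lia.
- by rewrite subrr normr0.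
apply: ler_wpM2r => //; have := IHk j.+1; rewrite addnS -kj => /(_ erefl w we).
exact: le_trans.
Qed.

(** * Interpolation polynomials *)

Section interpolation.
Variable R : realType.
Implicit Types (s : seq R) (f g : R -> R) (p : {poly R}).

Definition lagrange_basis s (a : R) : {poly R} :=
  \prod_(b <- s | b != a) ((a - b)^-1 *: ('X - b%:P)).

Definition interp s f : {poly R} := \sum_(a <- s) f a *: lagrange_basis s a.

Lemma lagrange_basis_self s a : (lagrange_basis s a).[a] = 1.
Proof.
rewrite horner_prod big1// => b ba; rewrite hornerZ hornerXsubC mulVf//.
by rewrite subr_eq0 eq_sym.
Qed.

Lemma lagrange_basis_other s a c : c \in s -> c != a -> (lagrange_basis s a).[c] = 0.
Proof.
move=> cs ca; rewrite horner_prod (big_rem c)//= ca hornerZ hornerXsubC subrr.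
by rewrite mulr0 mul0r.
Qed.

Lemma interp_horner s f a : uniq s -> a \in s -> (interp s f).[a] = f a.
Proof.
move=> us as_; rewrite horner_sum (bigD1_seq a)//= hornerZ lagrange_basis_self mulr1.
rewrite big1_seq ?addr0// => b /andP[ba _].
by rewrite hornerZ lagrange_basis_other// ?mulr0// eq_sym.
Qed.

Lemma lagrange_basisE s a : lagrange_basis s a =
  (\prod_(b <- s | b != a) (a - b)^-1) *: \prod_(b <- [seq b <- s | b != a]) ('X - b%:P).
Proof. by rewrite big_filter /lagrange_basis scaler_prod. Qed.

Lemma size_filter_neq s a : uniq s -> a \in s ->
  size [seq b <- s | b != a] = (size s).-1.
Proof.
move=> us as_; have := count_predC (pred1 a) s; rewrite size_filter.
rewrite count_uniq_mem// as_ => <-; rewrite add1n/=.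
by apply: eq_count.
Qed.

Lemma size_interp s f : uniq s -> (size (interp s f) <= size s)%N.
Proof.
move=> us; apply: (leq_trans (size_sum _ _ _)); apply/bigmax_leqP_seq => a as_ _.
rewrite (leq_trans (size_scale_leq _ _))// lagrange_basisE.
rewrite (leq_trans (size_scale_leq _ _))// size_prod_XsubC size_filter_neq//.
by case: s as_ {us}.
Qed.

Lemma interp_poly s p : uniq s -> (size p <= size s)%N -> interp s (horner p) = p.
Proof.
move=> us ps; apply/eqP; rewrite -subr_eq0; apply/eqP.
apply: (roots_geq_poly_eq0 _ us).
  by apply/allP => a as_; rewrite /root hornerD hornerN interp_horner// subrr.
rewrite (leq_trans (size_polyD _ _))// geq_max size_polyN ps andbT.
exact: size_interp.
Qed.

Lemma interp_linear s a f g : interp s (a *: f + g) = a *: interp s f + interp s g.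
Proof.
rewrite /interp scaler_sumr -big_split/=; apply: eq_bigr => b _.
by rewrite scalerA -scalerDl.
Qed.

Lemma eq_interp s f g : {in s, f =1 g} -> interp s f = interp s g.
Proof. by move=> fg; apply: eq_big_seq => a /fg ->. Qed.

Lemma derivn_mulXsubC p (b : R) (j : nat) :
  (('X - b%:P) * p)^`(j.+1) = ('X - b%:P) * p^`(j.+1) + p^`(j) *+ j.+1.
Proof.
elim: j => [|j IHj].
  by rewrite !derivn1 derivM derivB derivX derivC subr0 mul1r addrC derivn0 mulr1n.
rewrite derivnS IHj derivD derivM derivB derivX derivC subr0 mul1r derivMn -!derivnS.
by rewrite [in RHS]mulrS [RHS]addrCA addrA.
Qed.

(** The falling factorial counts the ordered choices of the [j] factors that are differentiated
    away. *)
Lemma prod_XsubC_derivn_bound s (z d : R) (j : nat) :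
  (forall b, b \in s -> `|z - b| <= d) ->
  `|((\prod_(b <- s) ('X - b%:P))^`(j)).[z]| <= (size s ^_ j)%:R * d ^+ (size s - j).
Proof.
elim: s j => [|b s IHs] j sd.
  rewrite big_nil; case: j => [|j]; first by rewrite derivn0 hornerC normr1 mul1r.
  by rewrite derivSn derivC derivn_poly0 ?size_poly0// horner0 normr0 mul0r.
have zb : `|z - b| <= d by apply: sd; rewrite mem_head.
have d0 : 0 <= d by exact: le_trans zb.
have {}IHs i := IHs i (fun b bs => sd _ (mem_behead (s := _ :: _) bs)).
rewrite big_cons; set p := \prod_(_ <- _) _ in IHs *; set n := size s in IHs *.
rewrite [size _]/=; case: j => [|j].
  have := IHs 0; rewrite !derivn0 !ffactn0 !mul1r !subn0 => IH0.
  by rewrite hornerM hornerXsubC normrM exprS ler_pM.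
rewrite derivn_mulXsubC hornerD hornerM hornerXsubC hornerMn subSS.
rewrite (le_trans (ler_normD _ _))// normrM normrMn.
have h1 : `|z - b| * `|p^`(j.+1).[z]| <= (n ^_ j.+1)%:R * d ^+ (n - j).
  apply: (@le_trans _ _ (d * ((n ^_ j.+1)%:R * d ^+ (n - j.+1)))).
    by rewrite ler_pM.
  have [jn|nj] := ltnP j n; last by rewrite ffact_small// !mul0r mulr0.
  by rewrite mulrCA -exprS (_ : (n - j.+1).+1 = (n - j)%N)//; lia.
have h2 : `|p^`(j).[z]| *+ j.+1 <= ((n ^_ j) * j.+1)%:R * d ^+ (n - j).
  by rewrite natrM mulrAC mulr_natr lerMn2r IHs orbT.
apply: (le_trans (lerD h1 h2)); rewrite -mulrDl ler_wpM2r ?exprn_ge0//.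
rewrite -natrD ler_nat ffactnSr ffactSS -mulnDr mulnC leq_mul2r.
have [jn|nj] := leqP j n; last by rewrite ffact_small.
by rewrite addnS subnK// leqnn orbT.
Qed.

(** The numerator has [k] linear factors of size at most [d], the denominator [k] differences of
    size at least [q]. With the diameter for [d] and the least distance for [q], the quotient is the
    one in the hypothesis of the theorem. *)
Lemma lagrange_basis_derivn_bound s (a z d q : R) (k j : nat) :
  uniq s -> a \in s -> size s = k.+1 -> 0 < q ->
  (forall b, b \in s -> `|z - b| <= d) ->
  (forall b, b \in s -> b != a -> q <= `|a - b|) ->
  `|((lagrange_basis s a)^`(j)).[z]| <= (k ^_ j)%:R * (d ^+ (k - j) / q ^+ k).
Proof.
move=> us as_ sk q0 sd sq; rewrite lagrange_basisE derivnZ hornerZ normrM mulrC.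
have fk : size [seq b <- s | b != a] = k by rewrite size_filter_neq// sk.
rewrite [X in _ <= X]mulrA ler_pM//.
  rewrite -[in X in _ <= X]fk; apply: prod_XsubC_derivn_bound => b.
  by rewrite mem_filter => /andP[_]; exact: sd.
rewrite -big_filter -exprVn -fk.
have : {in [seq b <- s | b != a], forall b, q <= `|a - b|}.
  by move=> b; rewrite mem_filter => /andP[ba bs]; exact: sq.
elim: [seq _ <- _ | _] => [|b r IHr] rq; first by rewrite big_nil normr1.
rewrite big_cons normrM exprS ler_pM//; last first.
  by apply: IHr => c cr; apply: rq; rewrite inE cr orbT.
have qb := rq b (mem_head _ _).
by rewrite normfV lef_pV2 ?posrE// (lt_le_trans q0).
Qed.


End interpolation.

(** * Abel-Goncharov interpolation *)

Section antiderivative.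
Variable R : realType.
Implicit Types (p q : {poly R}) (z v : nat -> R).

(* The constant coefficient is [p`_0 / 0 = 0]. *)
Definition antideriv p : {poly R} := \poly_(i < (size p).+1) (p`_i.-1 / i%:R).

Lemma coef_antideriv p i : (antideriv p)`_i = p`_i.-1 / i%:R.
Proof.
rewrite coef_poly; case: ltnP => // si.
by case: i si => [|i] si; rewrite ?invr0 ?mulr0// nth_default ?mul0r.
Qed.

Lemma deriv_antideriv p : (antideriv p)^`() = p.
Proof.
by apply/polyP => i; rewrite coef_deriv coef_antideriv/= -[LHS]mulr_natr divfK//.
Qed.

Lemma antideriv_linear (a : R) p q :
  antideriv (a *: p + q) = a *: antideriv p + antideriv q.
Proof.
apply/polyP => i; rewrite coefD coefZ !coef_antideriv coefD coefZ.
by rewrite mulrDl mulrA.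
Qed.

Lemma size_antideriv p : (size (antideriv p) <= (size p).+1)%N.
Proof. exact: size_poly. Qed.

(** The derivative of the solution solves the problem with shifted data; the one remaining constant
    of integration is fixed by the value at [z 0]. *)
Fixpoint abel_goncharov (k : nat) z v : {poly R} :=
  if k is k'.+1 then
    let p := antideriv (abel_goncharov k' (z \o S) (v \o S)) in
    p + (v 0 - p.[z 0])%:P
  else 0.

Lemma abel_goncharov_derivn k z v i : (i < k)%N ->
  ((abel_goncharov k z v)^`(i)).[z i] = v i.
Proof.
elim: k z v i => [//|k IHk] z v [_|i ik]; rewrite [abel_goncharov _ _ _]/=.
  by rewrite derivn0 hornerD hornerC addrC subrK.
by rewrite derivSn derivD derivC addr0 deriv_antideriv IHk.
Qed.

Lemma size_abel_goncharov k z v : (size (abel_goncharov k z v) <= k)%N.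
Proof.
elim: k z v => [|k IHk] z v /=; first by rewrite size_poly0.
rewrite (leq_trans (size_polyD _ _))// geq_max; apply/andP; split.
  by rewrite (leq_trans (size_antideriv _))// ltnS; exact: IHk.
by rewrite (leq_trans (size_polyC_leq1 _)).
Qed.

Lemma abel_goncharov_linear k z (a : R) v w :
  abel_goncharov k z (a *: v + w) = a *: abel_goncharov k z v + abel_goncharov k z w.
Proof.
elim: k z v w => [|k IHk] z v w /=; first by rewrite scaler0 addr0.
have -> : (a *: v + w) \o S = a *: (v \o S) + (w \o S) by [].
rewrite IHk antideriv_linear; set p := antideriv _; set q := antideriv _.
rewrite scalerDr addrACA; congr (_ + _).
have E : (a *: v + w) 0 = a * v 0 + w 0 by [].
by rewrite -[a *: _%:P]mul_polyC -polyCM -polyCD hornerD hornerZ E; congr (_%:P); ring.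
Qed.

End antiderivative.

(** The derivative of order [m] is zero, so [derivative_chain] applies with [D = 0] and a constant
    radius. *)
Lemma poly_chain_bound (R : realType) (p : {poly R}) (x e d : R) (z : nat -> R)
    (m j : nat) (y : R) :
  (size p <= m)%N -> 0 <= d -> 0 <= e <= 1 ->
  (forall i, (i < m)%N -> `|z i - x| <= e /\ `|(p^`(i)).[z i]| <= d) ->
  `|y - x| <= e -> `|(p^`(j)).[y]| <= 4 ^+ m * d.
Proof.
move=> pm d0 e01 zd ye; have [jm|mj] := leqP j m; last first.
  rewrite derivn_poly0 ?horner0 ?normr0 ?mulr_ge0 ?exprn_ge0//.
  by rewrite (leq_trans pm)// ltnW.
have := @derivative_chain R (horner p) x d 0 (fun=> e) z j m.
rewrite -derive1n_horner => /(_ (smooth_horner p) d0 (lexx _) jm) H.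
apply: (le_trans (H _ _ _ _ y ye)).
- by move=> _.
- by [].
- by move=> i /andP[_ im]; rewrite derive1n_horner; exact: zd.
- by move=> w _; rewrite derive1n_horner derivn_poly0// horner0 normr0.
rewrite mulr0 addr0 ler_wpM2r// ler_weXn2l ?leq_subr//.
by rewrite ler1n.
Qed.

(* By Rolle, the derivatives of order less than [size s] of the interpolation
   polynomial agree with those of [f] somewhere in the interval. *)
Lemma interp_derivn_bound (R : realType) (f : R -> R) (s : seq R) (x e d : R) (j : nat)
    (y : R) :
  smoothf f -> uniq s -> 0 <= d -> 0 <= e <= 1 ->
  (forall a, a \in s -> `|a - x| <= e) ->
  (forall i w, (i < size s)%N -> `|w - x| <= e -> `|derive1n i f w| <= d) ->
  `|y - x| <= e -> `|((interp s f)^`(j)).[y]| <= 4 ^+ size s * d.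
Proof.
move=> sf us d0 e01 se fd ye; pose g := f - horner (interp s f).
have sg : smoothf g by apply: smoothB => //; exact: smooth_horner.
have /choice[z zP] : forall i, exists z, (i < size s)%N ->
    `|z - x| <= e /\ `|((interp s f)^`(i)).[z]| <= d.
  move=> i; have [si|si] := ltnP i (size s); last by exists 0.
  have [|c||z zx] := @rolle_iter R g (sort <=%R s) (x - e) (x + e) i sg.
  - by rewrite sort_lt_sorted.
  - rewrite mem_sort => cs; split; first by rewrite (_ : g c = f c - (interp s f).[c])// interp_horner// subrr.
    by have := se c cs; rewrite ler_distl.
  - by rewrite size_sort.
  rewrite derive1nB//; last exact: smooth_horner.
  rewrite derive1n_horner => /eqP; rewrite subr_eq0 => /eqP zE; exists z => _.
  have ze : `|z - x| <= e by rewrite ler_distl.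
  by split=> //; rewrite -zE fd.
by apply: poly_chain_bound d0 e01 zP ye; exact: size_interp.
Qed.

(** * Local approximation at crowded points *)

Notation tau a := (2^-1 ^+ a) (only parsing).

(** Seminorm bounds are passed around as a relation, so that no supremum has to be formed. *)
Definition locally_bounded_by (R : realType) (F : R -> R) (x r : R) (m : nat) (B : R) :=
  forall i w, (i <= m)%N -> `|w - x| <= r -> `|derive1n i F w| <= B.

Lemma interp_functional_bound (R : realType) (s : seq R) (f : R -> R) (z L B : R)
    (j : nat) :
  0 <= B -> (forall a, a \in s -> `|((lagrange_basis s a)^`(j)).[z]| <= L) ->
  (forall a, a \in s -> `|f a| <= B) ->
  `|((interp s f)^`(j)).[z]| <= (size s)%:R * (L * B).
Proof.
move=> B0 sL sB; rewrite /interp linear_sum horner_sum.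
apply: (le_trans (ler_norm_sum _ _ _)).
rewrite -sum1_size natr_sum mulr_suml big_seq [leRHS]big_seq.
apply: ler_sum => a as_; rewrite linearZ hornerZ normrM mul1r mulrC.
by rewrite ler_pM// ?sL ?sB.
Qed.

Section local_approximation.
Variables (R : realType) (K : set R) (x : R) (k : nat) (e : nat -> R) (L : R).
Variables (nd : nat -> seq R) (z : nat -> R).
Hypothesis L0 : 0 <= L.
Hypothesis e01 : forall i, 0 <= e i <= 1.
Hypothesis eS : forall i, e i <= e i.+1.
Hypothesis nodes : forall i, (i < k.+1)%N ->
  [/\ uniq (nd i), size (nd i) = k.+1, z i \in nd i,
      forall a, a \in nd i -> K a /\ `|a - x| <= e i &
      forall a, a \in nd i -> `|((lagrange_basis (nd i) a)^`(i)).[z i]| <= L].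

(** An estimate of the [i]-th derivative at [z i] that uses only values of [f] on [K] and is exact
    on polynomials of size at most [k.+1]. *)
Definition node_value (f : R -> R) (i : nat) : R := ((interp (nd i) f)^`(i)).[z i].

(* Abel-Goncharov rather than Taylor: the [i]-th derivative is known at the node
   [z i], not at [x], and passing from [x] to [z i] costs only a factor [e i]. *)
Definition local_poly (f : R -> R) : {poly R} := abel_goncharov k.+1 z (node_value f).

Lemma local_poly_linear (a : R) (f g : R -> R) :
  local_poly (a *: f + g) = a *: local_poly f + local_poly g.
Proof.
rewrite /local_poly -abel_goncharov_linear; congr abel_goncharov.
apply/funext => i; rewrite /node_value interp_linear linearP hornerD hornerZ.
by [].
Qed.

Lemma eq_local_poly (f g : R -> R) :
  (forall y, K y -> f y = g y) -> local_poly f = local_poly g.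
Proof.
move=> fg; rewrite /local_poly.
suff : forall n z' (v w : nat -> R), (forall i, (i < n)%N -> v i = w i) ->
    abel_goncharov n z' v = abel_goncharov n z' w.
  apply=> i ik; rewrite /node_value (@eq_interp _ _ f g)// => a ai.
  by have [_ _ _ /(_ a ai)[Ka _] _] := nodes ik; exact: fg.
elim=> [//|n IHn] z' v w vw /=.
by rewrite (IHn _ _ (w \o S)) ?vw// => i ik; exact: vw.
Qed.

Let node_dist i a : (i < k.+1)%N -> a \in nd i -> `|a - x| <= 1.
Proof.
move=> ik ai; have [_ _ _ /(_ a ai)[_ ae] _] := nodes ik.
by rewrite (le_trans ae)//; case/andP: (e01 i).
Qed.

(** A crude bound from values on [K] alone. It serves at the top order of the chain and at small
    scales [s], where the fine estimate is not yet available. *)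
Lemma local_poly_bound (f : R -> R) (B : R) (j : nat) (y : R) :
  0 <= B -> (forall a, K a -> `|f a| <= B) -> `|y - x| <= 1 ->
  `|((local_poly f)^`(j)).[y]| <= 4 ^+ k.+1 * (k.+1%:R * (L * B)).
Proof.
move=> B0 fB yx; apply: (@poly_chain_bound _ _ x 1 _ z) => //.
- exact: size_abel_goncharov.
- by rewrite ?mulr_ge0 ?ler0n.
- by rewrite ler01 lexx.
move=> i ik; have [ui si zi ai Li] := nodes ik.
split; first exact: (node_dist ik zi).
rewrite abel_goncharov_derivn// -si; apply: interp_functional_bound => // a /ai[Ka _].
exact: fB.
Qed.

(** At [z i] the error is the interpolation of a Taylor remainder, which is small. At order [M] only
    the crude bound is known, but integrating down to order [j] multiplies it by the product of the
    radii [e i]. *)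
Lemma local_poly_approx (F : R -> R) (B : R) (M M' j : nat) (y : R) :
  smoothf F -> 0 <= B -> locally_bounded_by F x 3 M' B ->
  (j <= M <= M')%N -> (M' <= k.+1)%N -> `|y - x| <= e j ->
  (forall a, K a -> `|F a| <= B) ->
  `|derive1n j F y - ((local_poly F)^`(j)).[y]| <=
  4 ^+ (M - j) * (k.+1%:R * (L * ((2 * e M.-1) ^+ M' * B)) +
    \prod_(j <= i < M) e i * (B + 4 ^+ k.+1 * (k.+1%:R * (L * B)))).
Proof.
move=> sF B0 FB /andP[jM MM] Mk yj KB; pose G := F - horner (local_poly F).
have sG : smoothf G by apply: smoothB => //; exact: smooth_horner.
have GE i w : derive1n i G w = derive1n i F w - ((local_poly F)^`(i)).[w].
  by rewrite derive1nB ?derive1n_horner//; exact: smooth_horner.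
have ei i : 0 <= e i by case/andP: (e01 i).
have ele i l : (i <= l)%N -> e i <= e l.
  elim: l => [|l IHl]; first by rewrite leqn0 => /eqP ->.
  by rewrite leq_eqVlt => /predU1P[->//|/IHl il]; exact: le_trans (eS l).
rewrite -GE; apply: (@derivative_chain R G x _ _ e z) => //.
- by rewrite !mulr_ge0// exprn_ge0// mulr_ge0.
- by rewrite addr_ge0// !mulr_ge0// exprn_ge0.
- move=> i /andP[ji iM]; have ik : (i < k.+1)%N by rewrite (leq_trans iM)// (leq_trans MM).
  have [ui si zi ai Li] := nodes ik; split; first by have [] := ai _ zi.
  rewrite GE abel_goncharov_derivn// /node_value.
  (* As [M' <= k.+1], interpolation reproduces [T], and [T] has the right [i]-th derivative at
     [z i]; only the Taylor remainder on the nodes is left to interpolate. *)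
  pose T := taylor F (z i) M'.
  have Ti : (T^`(i)).[z i] = derive1n i F (z i) by rewrite taylor_derivn// (leq_trans iM).
  have iT : interp (nd i) (horner T) = T.
    by rewrite interp_poly// si (leq_trans (size_taylor _ _ _)).
  have -> : derive1n i F (z i) - ((interp (nd i) F)^`(i)).[z i] =
      ((interp (nd i) (horner T - F))^`(i)).[z i].
    rewrite -Ti -{1}iT -hornerN -hornerD -derivnB; congr (_^`(_)).[_].
    by rewrite addrC -scaleN1r -interp_linear scaleN1r addrC.
  rewrite -si; apply: interp_functional_bound => //.
    by rewrite mulr_ge0// exprn_ge0// mulr_ge0.
  move=> a aN; have [_ ae] := ai a aN; have [_ ze] := ai _ zi.
  have e1 : e i <= 1 by case/andP: (e01 i).
  have az : `|a - z i| <= 2 * e i.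
    by rewrite -(subrKA x) (le_trans (ler_normD _ _))// [ `|x - _|]distrC; lra.
  have -> : (horner T - F) a = - (F a - T.[a]) by rewrite opprB.
  rewrite normrN; apply: (@le_trans _ _ ((2 * e i) ^+ M' * B)).
    (* The ball of radius [2 * e i] around [z i], a point within [e i <= 1] of [x], lies in the ball
       of radius 3 around [x]. *)
    apply: taylor_bound => // w wz; apply: FB => //.
    by rewrite -(subrKA (z i)) (le_trans (ler_normD _ _))//; lra.
  rewrite ler_wpM2r// lerXn2r ?nnegrE ?mulr_ge0// ler_wpM2l// ele//.
  by rewrite -ltnS prednK// (leq_ltn_trans _ iM).
- move=> w wM; rewrite GE (le_trans (ler_normB _ _))//.
  have w1 : `|w - x| <= 1 by rewrite (le_trans wM)//; case/andP: (e01 M).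
  apply: lerD; last exact: local_poly_bound.
  by apply: FB => //; rewrite (le_trans w1)//; lra.
Qed.

End local_approximation.

(** * Powers of two and the rate of approximation *)

Lemma tau_gt0 (R : realType) (a : nat) : 0 < tau a :> R.
Proof. by rewrite exprn_gt0// invr_gt0. Qed.

Lemma tau_le1 (R : realType) (a : nat) : tau a <= 1 :> R.
Proof. by rewrite exprn_ile1 ?invr_ge0// invf_le1// ler1n. Qed.

Lemma ler_tau (R : realType) (a b : nat) : (a <= b)%N -> tau b <= tau a :> R.
Proof. by move=> ab; rewrite ler_wiXn2l ?invr_ge0// invf_le1// ler1n. Qed.

Lemma ler_pow2_tau (R : realType) (a b c d : nat) : (a + d <= b + c)%N ->
  2 ^+ a * tau b <= 2 ^+ c * tau d :> R.
Proof.
move=> h; rewrite !exprVn ler_pdivrMr ?exprn_gt0// mulrAC ler_pdivlMr ?exprn_gt0//.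
by rewrite -!exprD ler_weXn2l ?ler1n// addnC [(c + b)%N]addnC addnC.
Qed.

(* The divergence of the harmonic series, with integer parts. *)
Lemma harmonic_divn (j N : nat) : exists M E : nat, (j < M)%N /\
  forall s, (s * N <= \sum_(j <= i < M) s %/ i.+1 + E)%N.
Proof.
suff [M [E [jM h]]] : exists M E : nat, (j < M)%N /\
    forall s, (s * N.*2 <= (\sum_(j <= i < M) s %/ i.+1).*2 + E)%N.
  by exists M, E; split=> // s; have := h s; rewrite -!muln2; nia.
elim: N.*2 => {N} [|h [M [E [jM IHh]]]].
  by exists j.+1, 0%N; split=> // s; rewrite muln0.
(* The block from [M] to [2(M+1)] has [M+2] terms, each at least the integer part of [s/(2(M+1))],
   so it contributes [s/2] up to a constant; this is why the sum is doubled. *)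
exists (M.+1.*2), (E + M.+1.*2)%N; split=> [|s]; first by rewrite -muln2; lia.
have MM : (M <= M.+1.*2)%N by rewrite -muln2; lia.
rewrite (big_cat_nat (ltnW jM) MM)/=.
have : ((M.+1.*2 - M) * (s %/ M.+1.*2) <= \sum_(M <= i < M.+1.*2) s %/ i.+1)%N.
  rewrite -sum_nat_const_nat !big_nat; apply: leq_sum => i /andP[_ iM].
  exact: leq_div2l.
have := IHh s; have := divn_eq s M.+1.*2; have := ltn_pmod s (isT : 0 < M.+1.*2)%N.
set q := (s %/ M.+1.*2)%N; set r := (s %% M.+1.*2)%N; set S1 := (\sum_(_ <= _ < M) _)%N.
set S2 := (\sum_(_ <= _ < _) _)%N; rewrite -!muln2 => rM sE Ih S2q; nia.
Qed.

Lemma rate_arith (g s N M q E : nat) : (s * (N + g) <= (q * M + M) * (N + g))%N ->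
  (g * s + M * (N + g).+1 + s * N <= q * (M * (N + g).+1) + (M * (N + g).+1 + M * (N + g) + E))%N.
Proof.
rewrite [(g * s)%N]mulnC addnAC -mulnDr [(g + N)%N]addnC.
by move: (N + g)%N (s * _)%N => n m; rewrite mulnDl mulnS mulnDr mulnA; lia.
Qed.

(** The harmonic series with target [N + g] yields [M]: the product of the radii then beats the norm
    [2 ^+ (g * s)] and leaves order [N]. After that [M'] is taken large enough for the Taylor
    remainder. Losses to integer parts go into [C]. *)
Lemma approx_rate (R : realType) (g j N : nat) : exists M M' C : nat,
  [/\ (j < M)%N, (M <= M')%N & forall s,
    4 ^+ (M - j) * (2 ^+ (g * s) * (2 * tau (s %/ M)) ^+ M' +
      \prod_(j <= i < M) tau (s %/ i.+1) * (1 + 2 ^+ (g * s))) <=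
    2 ^+ C * tau (s * N) :> R].
Proof.
have [M [E [jM ME]]] := harmonic_divn j (N + g).
(* The factor [N + g] would already give the rate; the successor keeps [M'] at least [M] even if
   [N + g] is 0. *)
pose M' := (M * (N + g).+1)%N.
exists M, M', (2 * (M - j) + (M' + M * (N + g) + E).+2)%N; split; first exact: jM.
  by rewrite /M' leq_pmulr.
move=> s.
have M0 : (0 < M)%N by exact: leq_ltn_trans jM.
have h1 : 2 ^+ (g * s) * (2 * tau (s %/ M)) ^+ M' <=
    2 ^+ (M' + M * (N + g) + E) * tau (s * N) :> R.
  rewrite exprMn -exprM mulrA -exprD; apply: ler_pow2_tau.
  have := divn_eq s M; have := ltn_pmod s M0; rewrite /M'.
  set q := (s %/ M)%N; set r := (s %% M)%N => rM sE.
  by apply: rate_arith; rewrite sE leq_mul2r leq_add2l ltnW// orbT.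
have h2 : \prod_(j <= i < M) tau (s %/ i.+1) * (1 + 2 ^+ (g * s)) <=
    2 ^+ (M' + M * (N + g) + E).+1 * tau (s * N) :> R.
  rewrite -expr_sum; apply: (@le_trans _ _ (2 ^+ (g * s).+1 * tau (\sum_(j <= i < M) s %/ i.+1))).
    rewrite mulrC; apply: ler_wpM2r; first exact: ltW (tau_gt0 _ _).
    rewrite exprS.
    have : 1 <= 2 ^+ (g * s) :> R by rewrite exprn_ege1// ler1n.
    by lra.
  by apply: ler_pow2_tau; have := ME s; nia.
rewrite exprD (_ : 4 = 2 ^+ 2) -?exprM; last by ring.
rewrite -[leRHS]mulrA ler_wpM2l ?exprn_ge0//.
move: h1 h2; rewrite !exprS.
set X := 2 ^+ (_ + _); have T0 := tau_gt0 R (s * N).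
have X0 : 0 <= X * tau (s * N) :> R by rewrite mulr_ge0 ?ltW// exprn_gt0.
by set Y := X * _ in X0 *; rewrite -!mulrA -/Y; lra.
Qed.

(** Diagonal choice: [d s] is one more than the largest [k < s] that is good at [s], and 0 if there
    is none. No uniformity in [k] is required. *)
Lemma slow_growth (good : nat -> nat -> Prop) :
  (forall k, exists s0, forall s, (s0 <= s)%N -> good k s) ->
  exists d : nat -> nat, (forall s k, d s = k.+1 -> good k s) /\
    forall k, exists s0, forall s, (s0 <= s)%N -> (k < d s)%N.
Proof.
move=> gd.
pose top s := fix top n := if n is n'.+1 then
  if `[< good n' s >] then n else top n' else 0%N.
have topP s n k : top s n = k.+1 -> good k s.
  by elim: n => [//|n IHn] /=; case: asboolP => [gn [<-]|].
have top_gt s n k : (k < n)%N -> good k s -> (k < top s n)%N.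
  elim: n => [//|n IHn] kn gk /=; case: asboolP => [//|gn].
  apply: IHn => //; move: kn; rewrite ltnS leq_eqVlt => /predU1P[kn|//].
  by rewrite kn in gk.
exists (fun s => top s s); split=> [s k|k]; first exact: topP.
have [s0 gs0] := gd k; exists (maxn s0 k.+1) => s; rewrite geq_max => /andP[s0s ks].
by apply: top_gt => //; exact: gs0.
Qed.

(** * From the hypothesis to bounds on Lagrange bases *)

Lemma nodes_of_family (R : realType) (m k : nat) (y : 'I_k.+1 -> R) (C : R) :
  (m <= k)%N -> injective y ->
  sup [set `|y i - y v| | i in [set: 'I_k.+1] & v in [set: 'I_k.+1]] ^+ (k - m)
    / inf [set z | exists i v : 'I_k.+1, i != v /\ z = `|y i - y v|] ^+ k <= C ->
  exists s : seq R, [/\ uniq s, size s = k.+1, y ord0 \in s,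
    forall a, a \in s -> exists i, a = y i &
    forall a, a \in s -> `|((lagrange_basis s a)^`(m)).[y ord0]| <= k`!%:R * C].
Proof.
move=> mk yinj; set D := [set _ | _ in _ & _ in _]; set I := [set _ | _] => hC.
exists [seq y i | i <- enum 'I_k.+1].
have us : uniq [seq y i | i <- enum 'I_k.+1] by rewrite map_inj_uniq ?enum_uniq.
have ss : size [seq y i | i <- enum 'I_k.+1] = k.+1 by rewrite size_map size_enum_ord.
have ys i : y i \in [seq y i | i <- enum 'I_k.+1] by rewrite map_f ?mem_enum.
have sy a : a \in [seq y i | i <- enum 'I_k.+1] -> exists i, a = y i.
  by move=> /mapP[i _ ->]; exists i.
split=> // _ /sy[i ->].
have dD a b : `|y a - y b| <= sup D.
  apply: ub_le_sup; last by exists a => //; exists b.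
  exists (\sum_a \sum_b `|y a - y b|) => _ [c _ [d _ <-]].
  rewrite (bigD1 c)//= (bigD1 d)//= -addrA lerDl addr_ge0 ?sumr_ge0// => c' _.
  exact: sumr_ge0.
have D0 : 0 <= sup D by apply: le_trans (dD ord0 ord0).
(* For [k = 0] the set of distances between different nodes is empty, but all exponents are 0, so
   any positive [q] will do and 1 is taken. *)
have [k0|k0] := posnP k.
  subst k; have m0 : m = 0%N by move: mk; rewrite leqn0 => /eqP.
  subst m; rewrite (le_trans (@lagrange_basis_derivn_bound _ _ (y i) (y ord0) (sup D)
    1 0 0 us (ys i) ss ltr01 _ _))//.
  - by move=> _ /sy[b ->].
  - by move=> _ /sy[b ->]; rewrite !ord1 eqxx.
  - by move: hC; rewrite ffactn0 fact0 subnn !expr0 !mul1r.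
have [v0 [w0 vw0]] : exists v w : 'I_k.+1, v != w.
  by exists ord0, ord_max; rewrite -val_eqE /= eq_sym -lt0n.
have [q [q0 qI]] : exists q : R, 0 < q /\ lbound I q.
  pose q := \big[Order.min/1]_(p : 'I_k.+1 * 'I_k.+1 | p.1 != p.2) `|y p.1 - y p.2|.
  exists q; split.
    rewrite /q; elim/big_ind: _ => // [a b a0 b0|[a b] ab /=]; first by rewrite lt_min a0.
    by rewrite normr_gt0 subr_eq0 (inj_eq yinj).
  move=> _ [a [b [ab ->]]]; rewrite /q.
  by rewrite (bigD1 (a, b))//= ge_min lexx.
have I0 : 0 < inf I.
  apply: (lt_le_trans q0); apply: lb_le_inf => //.
  by exists `|y v0 - y w0|, v0, w0.
apply: (le_trans (@lagrange_basis_derivn_bound R _ (y i) (y ord0) (sup D) (inf I) k m us (ys i) ss I0 _ _)).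
- by move=> _ /sy[b ->].
- move=> _ /sy[b ->] bi; apply: ge_inf; first by exists q.
  by exists i, b; split=> //; apply: contra_neq bi => ->.
have : (0 <= sup D ^+ (k - m) / inf I ^+ k) by rewrite divr_ge0 ?exprn_ge0// ltW.
move=> X0; apply: ler_pM => //.
by rewrite ler_nat -(ffact_fact mk) leq_pmulr ?fact_gt0.
Qed.

Definition crowded (R : realType) (K : set R) (n : nat) (rho x : R) :=
  ~~ (K `&` `]x - rho, x + rho[ #<= `I_n.+1).

Lemma crowdedS (R : realType) (K : set R) (n : nat) (rho rho' x x' : R) :
  x' - rho' <= x - rho -> x + rho <= x' + rho' ->
  crowded K n rho x -> crowded K n rho' x'.
Proof.
move=> h1 h2; apply: contraNN; apply: card_le_trans; apply: subset_card_le.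
move=> y [Ky]; rewrite /= ?in_itv/= => /andP[yl yr]; split=> //.
by rewrite /= ?in_itv/= (le_lt_trans h1 yl) (lt_le_trans yr h2).
Qed.

(** The hypothesis in the form used below: integer exponents, and instead of the quotient of
    distances its consequence for the Lagrange basis. *)
Definition node_condition (R : realType) (K : set R) (n q g : nat) :=
  forall m k : nat, (m <= k)%N -> exists c e : R, [/\ 0 < c, 0 < e &
    forall eps x : R, 0 < eps < e -> K x -> crowded K n (eps ^+ q) x ->
    exists (s : seq R) (z : R), [/\ uniq s, size s = k.+1, z \in s,
      forall a, a \in s -> K a /\ `|a - x| <= eps &
      forall a, a \in s ->
        `|((lagrange_basis s a)^`(m)).[z]| <= c * (eps^-1) ^+ (g * m)]].

(** Both exponents are rounded up. For [eps <= 1] this shrinks the window in which points are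
    counted and enlarges the admissible bound, so the condition only gets weaker; hence the minimum
    with 1. *)
Lemma node_condition_of_powR (R : realType) (K : set R) (n : nat) :
  (exists r gamma : R, [/\ 1 <= r, 1 <= gamma &
    forall m k : nat, (m <= k)%N ->
    exists c eps_k : R, [/\ 0 < c, 0 < eps_k &
    forall eps x : R, 0 < eps < eps_k -> K x ->
    ~~ (K `&` `]x - eps `^ r, x + eps `^ r[ #<= `I_n.+1) ->
    exists y : 'I_k.+1 -> R,
      [/\ injective y,
          forall i, (K `&` `]x - eps, x + eps[) (y i) &
          sup [set `|y i - y v| | i in [set: 'I_k.+1] & v in [set: 'I_k.+1]] ^+ (k - m)
          / inf [set z | exists i v : 'I_k.+1, i != v /\ z = `|y i - y v|] ^+ k
          <= c / eps `^ (gamma * m%:R)]]]) ->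
  exists q g : nat, (0 < q)%N /\ node_condition K n q g.
Proof.
move=> [r [gamma [r1 g1 H]]]; exists (Num.truncn r).+1, (Num.truncn gamma).+1.
split=> // m k mk; have [c [e [c0 e0 He]]] := H m k mk.
exists (k`!%:R * c), (Num.min e 1); split.
- by rewrite mulr_gt0// ltr0n fact_gt0.
- by rewrite lt_min e0 ltr01.
move=> eps x /andP[eps0]; rewrite lt_min => /andP[epse eps1] Kx cx.
have eps01 : 0 < eps <= 1 by rewrite eps0 ltW.
have powr : eps ^+ (Num.truncn r).+1 <= eps `^ r.
  by rewrite -(powR_mulrn _ (ltW eps0)) ger_powR// ltW// truncnS_gt.
have [|//||y [yi yK ye]] := He eps x; first by rewrite eps0.
  by apply: crowdedS cx; lra.
have [s [us ss ys sy sb]] := nodes_of_family mk yi ye.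
exists s, (y ord0); split=> // a /[dup] ais /sy[i ai].
  rewrite ai; have [Ky] := yK i; rewrite /= ?in_itv/= => /andP[yl yr]; split=> //.
  by rewrite ler_distl; lra.
rewrite (le_trans (sb a ais))// -mulrA ler_wpM2l// ler_wpM2l ?(ltW c0)//.
rewrite exprVn lef_pV2 ?posrE ?powR_gt0 ?exprn_gt0//.
rewrite -(powR_mulrn _ (ltW eps0)) natrM ger_powR// ler_wpM2r// ltW//.
exact: truncnS_gt.
Qed.

Lemma card_le_seq (R : realType) (A : set R) (n : nat) : A #<= `I_n ->
  exists s : seq R, [/\ uniq s, (size s <= n)%N & A = [set` s]].
Proof.
move=> An; have fA : finite_set A by apply/finite_set_leP; exists n.
exists (fset_set A); split.
- exact: fset_uniq.
- exact: geq_card_fset_set.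
- by rewrite -[LHS](fset_setK fA).
Qed.

(* Scale [0] is a conventional start: it admits all of [K], and the local
   polynomials at that scale will be [0]. *)
Definition scale_set (R : realType) (K : set R) (n q s : nat) : set R :=
  if s is 0 then K else [set x | K x /\ crowded K n (tau (q * s)) x].

Definition linear_map (R : realType) (V : lmodType R) (T : (R -> R) -> V) :=
  forall (a : R) (f g : R -> R), T (a *: f + g) = a *: T f + T g.

(** The constructions act on arbitrary functions on the line; this property later lets them descend
    to functions on [K]. *)
Definition depends_on (R : realType) (K : set R) (V : Type) (T : (R -> R) -> V) :=
  forall f g : R -> R, (forall y, K y -> f y = g y) -> T f = T g.

Lemma pow2_unbounded (R : realType) (x : R) : exists t : nat, x < 2 ^+ t.
Proof.
exists (Num.truncn x).+1; rewrite (lt_le_trans (truncnS_gt _))//.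
by rewrite -natrX ler_nat ltnW// ltn_expl.
Qed.

(** * Approximating polynomials at every scale *)

Section approximants.
Variables (R : realType) (K : set R) (n q g : nat).
Hypothesis HK : node_condition K n q g.

(** The factor before the basis values is the one lost in [local_poly_bound]; building it in gives
    norms that do not mention [k]. *)
Definition good_nodes (k i s : nat) (x : R) :=
  exists (nd : seq R) (z : R), [/\ uniq nd, size nd = k.+1, z \in nd,
      forall a, a \in nd -> K a /\ `|a - x| <= tau (s %/ i.+1) &
      forall a, a \in nd -> 4 ^+ k.+1 * (k.+1%:R * `|((lagrange_basis nd a)^`(i)).[z]|)
        <= 2 ^+ (g.+1 * s)].

(** With [m = i] and [eps = 2^-(s/(i+1))] the cost of the condition is at most [2^(g s)], and for
    large [s] a further [2^s] absorbs the constants, including those depending on [k]. As [eps] is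
    at least [2^-s], a point crowded at scale [s] is crowded for [eps]. *)
Lemma node_data (k i : nat) : (i <= k)%N -> exists s0 : nat, forall s x,
  (s0 <= s)%N -> scale_set K n q s x -> (0 < s)%N ->
  good_nodes k i s x.
Proof.
move=> ik; have [c [e [c0 e0 He]]] := HK ik.
have [t tP] := pow2_unbounded (4 ^+ k.+1 * (k.+1%:R * c)).
have [t' t'P] : exists t' : nat, tau t' < e.
  have [t' ht] := pow2_unbounded e^-1; exists t'.
  by rewrite exprVn invf_plt ?posrE ?exprn_gt0.
exists (maxn t (t' * i.+1)%N) => s x; rewrite geq_max => /andP[ts t's] As s0.
have {As} [Kx cx] : K x /\ crowded K n (tau (q * s)) x by case: s s0 As {ts t's}.
have [|||nd [z [und snd znd and lnd]]] := He (tau (s %/ i.+1)) x.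
- rewrite tau_gt0/= (le_lt_trans _ t'P)// ler_tau// leq_divRL//.
- exact: Kx.
- apply: crowdedS cx; rewrite -exprM ?lerD2l ?lerN2 ler_tau// mulnC leq_mul2l leq_div ?orbT//.
exists nd, z; split=> // a ai.
rewrite mulrA (le_trans (ler_wpM2l _ (lnd a ai))) ?mulr_ge0 ?exprn_ge0//.
rewrite mulrA -[_ * c]mulrA mulSn exprD; apply: ler_pM.
- by rewrite !mulr_ge0 ?exprn_ge0// ltW.
- by rewrite exprn_ge0// invr_ge0 ltW// tau_gt0.
- by rewrite (le_trans (ltW tP))// ler_weXn2l ?ler1n.
rewrite -exprVn invrK -exprM ler_weXn2l ?ler1n// mulnCA leq_mul2l.
apply/orP; right; rewrite (leq_trans _ (leq_trunc_div s i.+1))//.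
by rewrite mulnS mulnC leq_addl.
Qed.

(* The degree of the local polynomials at scale [2^-s] is [d s - 1]. *)
Lemma local_polys : exists d : nat -> nat,
  (forall k, exists s0, forall s, (s0 <= s)%N -> (k < d s)%N) /\
  forall (s : nat) (x : R), exists P : (R -> R) -> {poly R},
  [/\ linear_map P, depends_on K P,
    forall (f : R -> R) (B : R) (j : nat) (y : R), 0 <= B -> (forall a, K a -> `|f a| <= B) -> `|y - x| <= 1 ->
      `|((P f)^`(j)).[y]| <= 2 ^+ (g.+1 * s) * B &
    scale_set K n q s x -> (0 < s)%N -> forall (F : R -> R) (B : R) (M M' j : nat) (y : R),
      smoothf F -> 0 <= B -> locally_bounded_by F x 3 M' B ->
      (forall a, K a -> `|F a| <= B) ->
      (j <= M <= M')%N -> (0 < M)%N -> (M' <= d s)%N -> `|y - x| <= tau s ->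
      `|derive1n j F y - ((P F)^`(j)).[y]| <= 4 ^+ (M - j) *
        (2 ^+ (g.+1 * s) * (2 * tau (s %/ M)) ^+ M' +
         \prod_(j <= i < M) tau (s %/ i.+1) * (1 + 2 ^+ (g.+1 * s))) * B].
Proof.
pose good k s := forall i x, (i <= k)%N -> scale_set K n q s x -> (0 < s)%N ->
  good_nodes k i s x.
have [k|d [dgood d_gt]] := @slow_growth good.
  have /choice[s0 s0P] : forall i, exists s0 : nat, (i <= k)%N -> forall s x,
      (s0 <= s)%N -> scale_set K n q s x -> (0 < s)%N ->
      good_nodes k i s x.
    move=> i; have [ik|_] := leqP i k; last by exists 0%N.
    by have [s0 s0P] := node_data ik; exists s0.
  exists (\max_(i < k.+1) s0 i) => s ss i x ik; apply: (s0P i ik).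
  by rewrite (leq_trans _ ss)// (leq_bigmax (Ordinal (ik : (i < k.+1)%N))).
exists d; split=> // s x.
(* Off the scale set, at scale 0, or when [d s] is 0, the zero polynomial serves: the approximation
   clause is then void, as it asks for [0 < M <= M' <= d s]. *)
have triv : exists P : (R -> R) -> {poly R}, [/\ linear_map P, depends_on K P &
    forall f B j y, 0 <= B -> (forall a, K a -> `|f a| <= B) -> `|y - x| <= 1 ->
      `|((P f)^`(j)).[y]| <= 2 ^+ (g.+1 * s) * B].
  exists (fun=> 0); split=> //; first by move=> a f h; rewrite scaler0 addr0.
  move=> f B j y B0 _ _.
  by rewrite derivn_poly0 ?size_poly0// horner0 normr0 mulr_ge0 ?exprn_ge0.
have [[Asx s_gt0]|nAs] := pselect (scale_set K n q s x /\ (0 < s)%N); last first.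
  have [P [Pl Pd Pb]] := triv; exists P; split=> // As s0.
  by case: nAs.
case ds : (d s) => [|k].
  have [P [Pl Pd Pb]] := triv; exists P; split=> // _ _ F B M M' j y _ _ _ _.
  by move=> /andP[_ MM'] M0 M'0; move: (leq_trans M0 (leq_trans MM' M'0)).
have gk : good k s by exact: dgood.
have /choice[ndz ndzP] : forall i, exists ndz : seq R * R, (i < k.+1)%N ->
    [/\ uniq ndz.1, size ndz.1 = k.+1, ndz.2 \in ndz.1,
    forall a, a \in ndz.1 -> K a /\ `|a - x| <= tau (s %/ i.+1) &
    forall a, a \in ndz.1 -> 4 ^+ k.+1 *
      (k.+1%:R * `|((lagrange_basis ndz.1 a)^`(i)).[ndz.2]|) <= 2 ^+ (g.+1 * s)].
  move=> i; have [ik|_] := ltnP i k.+1; last by exists ([::], 0).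
  by have [nd [z h]] := gk i x ik Asx s_gt0; exists (nd, z).
pose e i : R := tau (s %/ i.+1).
pose L : R := 2 ^+ (g.+1 * s) / (4 ^+ k.+1 * k.+1%:R).
have kk0 : 0 < 4 ^+ k.+1 * k.+1%:R :> R by rewrite mulr_gt0 ?exprn_gt0.
have LE : 4 ^+ k.+1 * (k.+1%:R * L) = 2 ^+ (g.+1 * s).
  by rewrite mulrA mulrC divfK// gt_eqF.
have L0 : 0 <= L by rewrite divr_ge0 ?exprn_ge0// ltW.
have e01 i : 0 <= e i <= 1 by rewrite ltW ?tau_gt0 ?tau_le1.
have eS i : e i <= e i.+1 by rewrite ler_tau// leq_div2l.
have nodes i : (i < k.+1)%N -> [/\ uniq (ndz i).1, size (ndz i).1 = k.+1,
    (ndz i).2 \in (ndz i).1,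
    forall a, a \in (ndz i).1 -> K a /\ `|a - x| <= e i &
    forall a, a \in (ndz i).1 -> `|((lagrange_basis (ndz i).1 a)^`(i)).[(ndz i).2]| <= L].
  move=> ik; have [h1 h2 h3 h4 h5] := ndzP i ik; split=> // a ai.
  by rewrite ler_pdivlMr// mulrC -mulrA h5.
have kL : k.+1%:R * L <= 2 ^+ (g.+1 * s).
  by rewrite -LE ler_peMl ?mulr_ge0// exprn_ege1// ler1n.
exists (local_poly k (fun i => (ndz i).1) (fun i => (ndz i).2)); split.
- exact: local_poly_linear.
- exact: (eq_local_poly nodes).
- move=> f B j y B0 fB yx.
  rewrite (le_trans (local_poly_bound L0 e01 nodes _ B0 fB yx))//.
  by rewrite [k.+1%:R * _]mulrA mulrA LE.
move=> _ _ F B M M' j y sF B0 FB KB jM M0 M'k yx.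
have yj : `|y - x| <= e j by rewrite (le_trans yx)// ler_tau// leq_div.
rewrite (le_trans (local_poly_approx L0 e01 eS nodes sF B0 FB jM M'k yj KB))//.
rewrite -[leRHS]mulrA ler_wpM2l ?exprn_ge0// [leRHS]mulrDl lerD//; last first.
  by rewrite le_eqVlt -LE; apply/orP; left; apply/eqP; ring.
set X := _ ^+ M'; have -> : k.+1%:R * (L * (X * B)) = k.+1%:R * L * X * B by ring.
by rewrite ler_wpM2r// /X /e prednK// ler_wpM2r.
Qed.

(** The order [M'] of [approx_rate] is admissible once [d s] exceeds it. That fails only below some
    [s0], where the crude bound is enough, since finitely many scales just enlarge [C]; at scale 0
    the error is [F] itself. *)
Lemma approximants : exists P : nat -> R -> (R -> R) -> {poly R},
  [/\ forall s x, linear_map (P s x), forall s x, depends_on K (P s x),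
    forall x f, P 0 x f = 0 &
    forall j N, exists M C : nat, forall (s : nat) (x : R) (F : R -> R) (B y : R), scale_set K n q s x ->
      smoothf F -> 0 <= B -> locally_bounded_by F x 3 M B ->
      (forall a, K a -> `|F a| <= B) -> `|y - x| <= tau s ->
      `|derive1n j F y - ((P s x F)^`(j)).[y]| <= 2 ^+ C * tau (s * N) * B].
Proof.
have [d [d_gt dP]] := local_polys.
pose P0 s := projT1 (choice (dP s)); have P0P s := projT2 (choice (dP s)).
rewrite -/(P0 _) in P0P.
exists (fun s x => if s is 0 then fun=> 0 else P0 s x); split.
- by move=> [|s] x; [move=> a f h; rewrite scaler0 addr0|have [] := P0P s.+1 x].
- by move=> [|s] x; [|have [] := P0P s.+1 x].
- by [].
move=> j N; have [M [M' [C [jM MM' CP]]]] := approx_rate R g.+1 j N.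
have [s0 s0P] := d_gt M'.
have M0 : (0 < M)%N by exact: leq_ltn_trans jM.
exists M', (C + (g.+1 * s0 + s0 * N).+1)%N => s x F B y As sF B0 FB KB yx.
have yx1 : `|y - x| <= 1 by rewrite (le_trans yx)// tau_le1.
have FjB : `|derive1n j F y| <= B.
  by apply: FB; [rewrite (leq_trans (ltnW jM))|lra].
have one_le a : 1 <= 2 ^+ a :> R by rewrite exprn_ege1// ler1n.
case: s As yx => [|s] As yx.
  rewrite derivn_poly0 ?size_poly0// horner0 subr0 mul0n expr0 mulr1.
  by rewrite (le_trans FjB)// ler_peMl.
have [Pl Pd Pb Pa] := P0P s.+1 x.
have [ss|ss] := leqP s0 s.+1.
  rewrite (le_trans (Pa As isT F B M M' j y sF B0 FB KB _ M0 _ yx))//.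
  - by rewrite (ltnW jM).
  - by rewrite ltnW// s0P.
  rewrite ler_wpM2r// (le_trans (CP s.+1))// ler_wpM2r ?(ltW (tau_gt0 _ _))//.
  by rewrite ler_weXn2l ?ler1n// leq_addr.
rewrite (le_trans (ler_normB _ _))// (le_trans (lerD FjB (Pb F B j y B0 KB yx1)))//.
rewrite -{1}[B]mul1r -mulrDl ler_wpM2r//.
apply: (@le_trans _ _ (2 ^+ (g.+1 * s.+1).+1)).
  by rewrite exprS; have := one_le (g.+1 * s.+1)%N; lra.
rewrite -[leLHS]mulr1 -(expr0 2^-1); apply: ler_pow2_tau; rewrite add0n.
by rewrite addSn (leq_trans _ (leq_addl _ _))// ltnS leq_add// ?leq_mul2r ?leq_mul// ltnW ?orbT.
Qed.

End approximants.

(** * A smooth partition of unity *)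

(** Used twice in place of a limit argument: for flat functions at 0 and for series differentiated
    term by term. *)
Lemma is_derive_quadratic (R : realType) (f : R -> R) (x d C : R) :
  (forall h, `|f (x + h) - f x - h * d| <= C * h ^+ 2) -> is_derive x 1 f d.
Proof.
move=> fC; have C0 : 0 <= C by have := le_trans (normr_ge0 _) (fC 1); rewrite expr1n mulr1.
suff H : (fun h : R => h^-1 *: ((f \o shift x) (h *: 1) - f x)) @ 0^' --> d.
  by apply: DeriveDef; [apply/cvg_ex; exists d|exact: cvg_lim H].
apply/cvgrPdist_le => /= e e0; near=> h.
have h0 : h != 0 by near: h; exact: nbhs_dnbhs_neq.
have hC : `|h| <= e / (C + 1).
  near: h; apply: dnbhs0_le.
  by rewrite divr_gt0// ltr_wpDl.
rewrite [h%:A](mulr1) [h + x]addrC.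
rewrite -(ler_pM2l (_ : 0 < `|h|)) ?normr_gt0// -normrM mulrBr.
rewrite [h * (_ *: _)]mulrA divff// mul1r distrC (le_trans (fC h))// -(real_normK (num_real h)) expr2 mulrCA ler_wpM2l//.
apply: (@le_trans _ _ ((C + 1) * `|h|)); first by rewrite ler_wpM2r// lerDl.
by rewrite mulrC -ler_pdivlMr// ltr_wpDl.
Unshelve. all: by end_near. Qed.

Lemma derive1n_eq0 (R : realType) (f : R -> R) (U : set R) (j : nat) (x : R) :
  open U -> (forall y, U y -> f y = 0) -> U x -> derive1n j f x = 0.
Proof.
move=> oU; elim: j f x => [|j IHj] f x f0 Ux; first exact: f0.
rewrite derive1Sn; apply: IHj Ux => y Uy; rewrite derive1E.
rewrite (@near_eq_derive _ _ _ f (cst 0)) ?derive_cst//.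
by near=> w; apply: f0; near: w; exact: open_nbhs_nbhs.
Unshelve. all: by end_near. Qed.

Section smooth_step.
Variable R : realType.
Implicit Types (p : {poly R}) (x y : R).

Lemma horner_le_expR p : exists C : R, 0 <= C /\ forall x, 0 <= x -> `|p.[x]| <= C * expR x.
Proof.
exists (\sum_(i < size p) `|p`_i| * i`!%:R); split.
  by apply: sumr_ge0 => i _; rewrite mulr_ge0.
move=> x x0; rewrite horner_coef (le_trans (ler_norm_sum _ _ _))// mulr_suml.
apply: ler_sum => i _; rewrite normrM -mulrA ler_wpM2l//.
rewrite ger0_norm ?exprn_ge0//; case: (nat_of_ord i) => [|k].
  by rewrite expr0 fact0 mul1r (le_trans _ (expR_ge1Dx x))// lerDl.
rewrite mulrC -ler_pdivrMr ?ltr0n ?fact_gt0//.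
by rewrite (le_trans _ (expR_ge1Dxn k x0))// lerDr.
Qed.

(** The functions [p(1/x) exp(-1/x)], extended by 0, are closed under differentiation, which turns
    [p] into [X^2 (p - p')]. Smoothness of the whole family thus needs only one derivative. *)
Definition flat p x : R := if 0 < x then p.[x^-1] * expR (- x^-1) else 0.

Lemma flat_derive p x : is_derive x 1 (flat p) (flat ('X^2 * (p - p^`())) x).
Proof.
have [x0|x0|->] := ltgtP x 0; last 1 first.
(* At the origin: bounding [X^2 p] by a multiple of the exponential at [1/h] says that [flat p h] is
   at most [C h^2]. *)
- have [C [C0 CP]] := horner_le_expR ('X^2 * p).
  rewrite {2}/flat ltxx; apply: (@is_derive_quadratic _ _ _ _ C) => h.
  rewrite add0r mulr0 subr0 /flat ltxx subr0; case: ifPn => h0; last first.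
    by rewrite normr0 mulr_ge0// sqr_ge0.
  have hV : 0 <= h^-1 by rewrite invr_ge0 ltW.
  have := CP _ hV; rewrite hornerM hornerXn normrM ger0_norm ?exprn_ge0//.
  rewrite exprVn mulrC ler_pdivrMr ?exprn_gt0// => H.
  rewrite expRN normrM [X in _ * X <= _]ger0_norm ?invr_ge0 ?expR_ge0//.
  by rewrite ler_pdivrMr ?expR_gt0// mulrAC.
- rewrite {2}/flat ltNge ltW//=; apply: (@near_eq_is_derive _ _ _ (cst 0)).
    near=> y; rewrite /flat ltNge ltW//=.
    by near: y; exact: lt_nbhsl.
- have xn0 : x != 0 by rewrite gt_eqF.
  rewrite {2}/flat x0.
  pose f y := p.[y^-1] * expR (- y^-1).
  apply: (@near_eq_is_derive _ _ _ f).
    near=> y; rewrite /flat (_ : 0 < y)//.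
    by near: y; exact: lt_nbhsr.
  have dV : is_derive x 1 (fun y : R => y^-1) (- x ^- 2).
    apply: is_derive_eq; first exact: (@is_deriveV _ id).
    by rewrite /GRing.scale/= mulr1.
  have dp : is_derive x 1 (fun y : R => p.[y^-1]) (p^`().[x^-1] * - x ^- 2).
    exact: (@is_derive1_comp _ (horner p) (fun y => y^-1)).
  have de : is_derive x 1 (fun y : R => expR (- y^-1)) (expR (- x^-1) * x ^- 2).
    have dN : is_derive x 1 (fun y : R => - y^-1) (- - x ^- 2) by exact: is_deriveN.
    by rewrite -[x ^- 2]opprK; exact: (@is_derive1_comp _ expR (fun y => - y^-1)).
  apply: (is_derive_eq (is_deriveM dp de)).
  by rewrite !hornerE /GRing.scale/= -exprVn; ring.
Unshelve. all: by end_near. Qed.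

Lemma flat_smooth p : smoothf (flat p).
Proof.
apply: diffn_smooth => j; elim: j p => [|j IHj] p; first exact: diffn0.
apply/diffnS; split=> [x|]; first exact: (ex_derive (is_derive := flat_derive p x)).
have -> : derive1 (flat p) = flat ('X^2 * (p - p^`())); last exact: IHj.
by apply/funext => x; rewrite derive1E; exact: (derive_val (is_derive := flat_derive p x)).
Qed.

Let E := flat 1.

Lemma smooth_step : exists sigma : R -> R, [/\ smoothf sigma,
  forall x, x <= 0 -> sigma x = 0 & forall x, 1 <= x -> sigma x = 1].
Proof.
have E0 x : x <= 0 -> E x = 0 by rewrite leNgt /E /flat => /negbTE ->.
have Egt x : 0 < x -> 0 < E x by move=> x0; rewrite /E /flat x0 hornerC mul1r expR_gt0.
have Ege x : 0 <= E x.
  by have [/Egt/ltW//|/E0 ->] := ltP 0 x.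
have D0 x : E x + E (-1 * x + 1) != 0.
  rewrite gt_eqF//; have [x0|x0] := ltP 0 x; first by rewrite ltr_pwDl// Egt.
  by rewrite ltr_wpDl// Egt//; lra.
pose sigma := E * (fun x => (E x + E (-1 * x + 1))^-1).
have sigmaE x : sigma x = E x / (E x + E (-1 * x + 1)) by [].
exists sigma; split.
- apply: smoothM; first exact: flat_smooth.
  apply: smoothV => //; apply: smoothD; first exact: flat_smooth.
  by apply: smooth_affine; exact: flat_smooth.
- by move=> x x0; rewrite sigmaE E0// mul0r.
- move=> x x1; rewrite sigmaE [E (-1 * x + 1)]E0 ?addr0 ?divff// ?gt_eqF ?Egt//; lra.
Qed.

End smooth_step.

Lemma open_dist_gt (R : realType) (c r : R) : open [set y | r < `|y - c|].
Proof.
apply: (@open_comp _ _ (fun y : R => `|y - c|) [set x | r < x]); last exact: open_gt.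
by move=> y _; apply: cvg_norm; apply: cvgB; [exact: cvg_id|exact: cvg_cst].
Qed.

(** For a smooth step [sigma] take [sigma(x+1) - sigma(x)]: the two terms agree outside [[-1,1]],
    and sums of integer translates telescope. *)
Lemma smooth_bump (R : realType) : exists theta : R -> R, [/\ smoothf theta,
  forall x, 1 <= `|x| -> theta x = 0,
  forall (n : nat) (u : R), 0 <= u <= n%:R -> \sum_(i < n.+1) theta (u - i%:R) = 1 &
  forall j, exists B : R, 0 <= B /\ forall x, `|derive1n j theta x| <= B].
Proof.
have [sigma [ss s0 s1]] := smooth_step R.
pose theta x := sigma (1 * x + 1) - sigma x.
have thetaE x : theta x = sigma (x + 1) - sigma x by rewrite /theta mul1r.
have st : smoothf theta by apply: smoothB => //; exact: smooth_affine.
have t0 x : 1 <= `|x| -> theta x = 0.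
  rewrite thetaE ler_normr => /orP[x1|x1]; first by rewrite !s1 ?subrr//; lra.
  by rewrite !s0 ?subrr//; lra.
exists theta; split=> // [n u /andP[u0 un]|j].
  suff -> : \sum_(i < n.+1) theta (u - i%:R) = sigma (u + 1) - sigma (u - n%:R).
    by rewrite s1 ?s0 ?subr0//; lra.
  elim: n {un} => [|n IHn]; first by rewrite big_ord1 thetaE subr0.
  rewrite big_ord_recr/= IHn thetaE -natr1.
  by rewrite (_ : u - (n%:R + 1) + 1 = u - n%:R) ?addrA ?subrK//; ring.
have [||c c11 cP] := @EVT_max R (fun x => `|derive1n j theta x|) (-1) 1.
- by lra.
- apply: continuous_subspaceT => x; apply: cvg_norm; exact: smooth_continuous.
exists `|derive1n j theta c|; split=> // x; have [x1|x1] := leP `|x| 1.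
  by apply: cP; rewrite in_itv/= -ler_norml.
rewrite (@derive1n_eq0 _ _ [set x | 1 < `|x - 0|]) ?normr0//= ?subr0//.
  exact: open_dist_gt.
by move=> y; rewrite subr0 => /ltW; exact: t0.
Qed.

(** * Cutoffs on a dyadic grid *)

Section grid.
Variables (R : realType) (theta : R -> R) (q A : nat).
Hypothesis theta_smooth : smoothf theta.
Hypothesis theta_supp : forall x, 1 <= `|x| -> theta x = 0.
Hypothesis theta_sum : forall (n : nat) (u : R), 0 <= u <= n%:R ->
  \sum_(i < n.+1) theta (u - i%:R) = 1.

(** The 2 makes the radius of a cell a quarter of the counting radius [2^-(q s)], so the window
    around a point contains every cell in which the point lies. *)
Definition cell_exp (s : nat) : nat := (q * s + 2)%N.

Definition grid_size (s : nat) : nat := (A.*2 * 2 ^ cell_exp s).+1.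

Definition cell_center (s i : nat) : R := i%:R * tau (cell_exp s) - A%:R.

(** The argument is the rescaled displacement from the cell center, expanded into the affine form of
    [derive1n_affine]. *)
Definition cutoff (s i : nat) (y : R) : R :=
  theta (2 ^+ cell_exp s * y + (2 ^+ cell_exp s * A%:R - i%:R)).

Lemma cutoff_smooth s i : smoothf (cutoff s i).
Proof. exact: smooth_affine. Qed.

Lemma cutoff_argE s i y : 2 ^+ cell_exp s * y + (2 ^+ cell_exp s * A%:R - i%:R) =
  2 ^+ cell_exp s * (y - cell_center s i).
Proof.
by rewrite /cell_center opprB mulrDr mulrBr exprVn [i%:R * _]mulrC mulVKf//.
Qed.

Lemma cutoff_derive_bound (B : R) j s i y : (forall x, `|derive1n j theta x| <= B) ->
  `|derive1n j (cutoff s i) y| <= 2 ^+ (cell_exp s * j) * B.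
Proof.
move=> tB; rewrite derive1n_affine// normrM exprM ler_pM//.
by rewrite ger0_norm// !exprn_ge0.
Qed.

Lemma cutoff_supp s i y : tau (cell_exp s) <= `|y - cell_center s i| -> cutoff s i y = 0.
Proof.
move=> h; apply: theta_supp; rewrite cutoff_argE normrM ger0_norm ?exprn_ge0//.
by move: h; rewrite exprVn -[_^-1]mulr1 ler_pdivrMl ?exprn_gt0.
Qed.

Lemma cutoff_derive_supp s i y j : tau (cell_exp s) < `|y - cell_center s i| ->
  derive1n j (cutoff s i) y = 0.
Proof.
move=> h; apply: (@derive1n_eq0 _ _ [set y | tau (cell_exp s) < `|y - cell_center s i|]).
- exact: open_dist_gt.
- by move=> z /= /ltW; exact: cutoff_supp.
- exact: h.
Qed.

Lemma cutoff_sum s y : `|y| <= A%:R -> \sum_(i < grid_size s) cutoff s i y = 1.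
Proof.
rewrite ler_norml => /andP[Ay yA].
rewrite -[RHS](theta_sum (n := A.*2 * 2 ^ cell_exp s) (u := 2 ^+ cell_exp s * (y + A%:R))).
  by apply: eq_bigr => i _; rewrite /cutoff mulrDr addrA.
rewrite mulr_ge0 ?exprn_ge0//=; last by lra.
rewrite natrM natrX mulrC ler_wpM2r ?exprn_ge0// -addnn natrD; lra.
Qed.

End grid.

Lemma geometric_series_bound (R : realType) (a : nat -> R) (D : R) :
  (forall s, `|a s| <= D * tau s) ->
  cvgn (series a) /\ `|limn (series a)| <= 2 * D.
Proof.
move=> aD.
have h1 : `|2^-1 : R| < 1 by rewrite ger0_norm ?invr_ge0// invf_lt1// ltr1n.
have gl := @cvg_geometric_series R D 2^-1 h1.
have gc : cvgn (series (geometric D 2^-1)) by apply/cvg_ex; eexists; exact: gl.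
have nc : cvgn [normed series a].
  apply: (@series_le_cvg _ (fun n => `|a n|) (geometric D 2^-1)) => // n.
  by rewrite (le_trans _ (aD n)).
split; first exact: normed_cvg.
rewrite (le_trans (lim_series_norm nc))// (le_trans (lim_series_le nc gc aD))//.
by rewrite (cvg_lim _ gl)// mulrC (_ : 1 - 2^-1 = 2^-1) ?invrK//; lra.
Qed.

(** * Series of smooth functions *)

Section smooth_series.
Variables (R : realType) (T : nat -> R -> R) (C : nat -> R).
Hypothesis T_smooth : forall s, smoothf (T s).
Hypothesis TC : forall j s y, `|derive1n j (T s) y| <= C j * tau s.

Definition derive_series (j : nat) (y : R) : R :=
  limn (series (fun s => derive1n j (T s) y)).

(** The second-order Taylor remainders of the terms sum to at most a multiple of [h^2], so
    [is_derive_quadratic] gives termwise differentiation. *)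
Lemma derive_series_is_derive j (y : R) :
  is_derive y 1 (derive_series j) (derive_series j.+1 y).
Proof.
apply: (@is_derive_quadratic _ _ _ _ (2 * C j.+2)) => h.
pose u s := derive1n j (T s) (y + h); pose v s := derive1n j (T s) y.
pose w s := derive1n j.+1 (T s) y.
have [uc _] : cvgn (series u) /\ _ := geometric_series_bound (fun s => TC j s (y + h)).
have [vc _] : cvgn (series v) /\ _ := geometric_series_bound (fun s => TC j s y).
have [wc _] : cvgn (series w) /\ _ := geometric_series_bound (fun s => TC j.+1 s y).
have hw : cvgn (series (h *: w)) by exact: is_cvg_seriesZ.
have uv : cvgn (series (u - v)) by exact: is_cvg_seriesB.
have -> : derive_series j (y + h) - derive_series j y - h * derive_series j.+1 y =
    limn (series (u - v - h *: w)).
  by rewrite (lim_seriesB uv hw) (lim_seriesB uc vc) (lim_seriesZ _ wc).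
have [s|_ H] := @geometric_series_bound R (u - v - h *: w) (C j.+2 * h ^+ 2).
  have -> : (u - v - h *: w) s = u s - (taylor (derive1n j (T s)) y 2).[y + h].
    have -> : (u - v - h *: w) s = u s - v s - h * w s by [].
    rewrite /taylor !big_ord_recl big_ord0 addr0 /= !fact0 !divr1 !hornerE.
    by rewrite /u /v /w derive1nS; ring.
  have := @taylor_bound R (derive1n j (T s)) y `|h| (C j.+2 * tau s) (y + h) 2.
  rewrite real_normK ?num_real// => H; rewrite mulrAC [leRHS]mulrC; apply: H.
  - exact: smooth_derive1n.
  - by move=> z _; rewrite derive1n_add; exact: TC.
  - by rewrite addrAC subrr add0r.
by rewrite (le_trans H)// mulrA.
Qed.

Lemma derive_seriesE j : derive1n j (derive_series 0) = derive_series j.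
Proof.
elim: j => [//|j IHj]; rewrite derive1nS IHj; apply/funext => y.
by rewrite derive1E; exact: (derive_val (is_derive := derive_series_is_derive j y)).
Qed.

Lemma smooth_series_sum : smoothf (derive_series 0).
Proof.
apply/smoothfP => j y; rewrite derive_seriesE.
exact: (ex_derive (is_derive := derive_series_is_derive j y)).
Qed.

Lemma derive_series_bound j y : `|derive1n j (derive_series 0) y| <= 2 * C j.
Proof.
rewrite derive_seriesE.
by have [_] := geometric_series_bound (fun s => TC j s y).
Qed.

Lemma derive_series_cvg y : cvgn (series (fun s => T s y)).
Proof. by have [] := geometric_series_bound (fun s => TC 0 s y). Qed.

End smooth_series.

(** * Gluing *)

Lemma smooth_locally_bounded (R : realType) (F : R -> R) (x r : R) (m : nat) :
  smoothf F -> exists B, 0 <= B /\ locally_bounded_by F x r m B.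
Proof.
move=> sF; have [r0|r0] := leP 0 r; last first.
  exists 0; split=> // i w _ wr.
  by have := le_trans (normr_ge0 _) wr; rewrite leNgt r0.
have bd i : exists B, 0 <= B /\ forall w, `|w - x| <= r -> `|derive1n i F w| <= B.
  have [||c _ cP] := @EVT_max R (fun w => `|derive1n i F w|) (x - r) (x + r).
  - by lra.
  - apply: continuous_subspaceT => w; apply: cvg_norm; exact: smooth_continuous.
  exists `|derive1n i F c|; split=> // w wr; apply: cP.
  by rewrite in_itv/= -ler_distl.
have /choice[B BP] := bd.
exists (\sum_(i < m.+1) B i); split; first by apply: sumr_ge0 => i _; have [] := BP i.
move=> i w im wr; have [_ /(_ w wr) /le_trans] := BP i; apply.
rewrite (bigD1 (Ordinal (im : (i < m.+1)%N)))//= lerDl.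
by apply: sumr_ge0 => l _; have [] := BP l.
Qed.

Lemma locally_bounded_byW (R : realType) (F : R -> R) (x r x' r' : R) (m m' : nat) (B : R) :
  (m <= m')%N -> `|x - x'| + r <= r' ->
  locally_bounded_by F x' r' m' B -> locally_bounded_by F x r m B.
Proof.
move=> mm rr FB i w im wr; apply: FB; first exact: leq_trans mm.
by rewrite -(subrKA x) (le_trans (ler_normD _ _))//; lra.
Qed.

Lemma derive1nM_eq0 (R : realType) (f g : R -> R) (x : R) (j : nat) :
  smoothf f -> smoothf g -> (forall i, (i <= j)%N -> derive1n i f x = 0) ->
  derive1n j (f * g) x = 0.
Proof.
move=> sf sg f0; apply/normr0_eq0/le_anti; rewrite normr_ge0 andbT.
have := @derive1nM_bound R f g x 0 (\sum_(i < j.+1) `|derive1n i g x|) j sf sg.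
rewrite mul0r mulr0; apply=> i ij; first by rewrite f0// normr0.
by rewrite (bigD1 (Ordinal (ij : (i < j.+1)%N)))//= lerDl sumr_ge0.
Qed.

Section gluing.
Variables (R : realType) (K : set R) (n q A : nat) (theta : R -> R).
Variable P : nat -> R -> (R -> R) -> {poly R}.
Hypothesis q_gt0 : (0 < q)%N.
Hypothesis K_bounded : forall x, K x -> `|x| + 4 <= A%:R.
Hypothesis theta_smooth : smoothf theta.
Hypothesis theta_supp : forall x, 1 <= `|x| -> theta x = 0.
Hypothesis theta_sum : forall (m : nat) (u : R), 0 <= u <= m%:R ->
  \sum_(i < m.+1) theta (u - i%:R) = 1.
Hypothesis theta_bounded : forall j, exists B : R, 0 <= B /\
  forall x, `|derive1n j theta x| <= B.
Hypothesis P_linear : forall s x, linear_map (P s x).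
Hypothesis P_depends : forall s x, depends_on K (P s x).
Hypothesis P_0 : forall x f, P 0 x f = 0.
Hypothesis P_approx : forall j N, exists M C : nat,
  forall (s : nat) (x : R) (F : R -> R) (B y : R), scale_set K n q s x ->
  smoothf F -> 0 <= B -> locally_bounded_by F x 3 M B ->
  (forall a, K a -> `|F a| <= B) -> `|y - x| <= tau s ->
  `|derive1n j F y - ((P s x F)^`(j)).[y]| <= 2 ^+ C * tau (s * N) * B.

Local Notation center := (@cell_center R q A).
Local Notation h s := (tau (cell_exp q s) : R).
Local Notation phi := (cutoff theta q A).

Definition active s i := exists z, scale_set K n q s z /\ `|z - center s i| < h s.

Definition anchor s i : R :=
  xget 0 [set z | scale_set K n q s z /\ `|z - center s i| < h s].

Definition sparse_nodes s i : seq R := xget [::] [set t : seq R |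
  [/\ uniq t, (size t <= n.+1)%N & forall z, z \in t <-> K z /\ `|z - center s i| < h s]].

(* A cell that is not active at scale [s.+1] contains at most [n.+1] points of
   [K]; there the error of the coarser polynomial is interpolated exactly, which
   makes the increments telescope on [K]. *)
Definition correction s l i (f : R -> R) : {poly R} :=
  if `[< active s.+1 i >] then P s.+1 (anchor s.+1 i) f - P s (anchor s l) f
  else interp (sparse_nodes s.+1 i) (f - horner (P s (anchor s l) f)).

Definition increment s (f : R -> R) : R -> R :=
  \sum_(l < grid_size q A s | `[< active s l >]) \sum_(i < grid_size q A s.+1)
    (phi s l * phi s.+1 i) * horner (correction s l i f).

(** What is still missing at a point of [K] after the increments below scale [s]. It is 0 where no
    active cell reaches, as [f] is already reproduced there. *)
Definition defect s (f : R -> R) x : R :=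
  \sum_(l < grid_size q A s | `[< active s l >])
    phi s l x * (f x - (P s (anchor s l) f).[x]).

Lemma scale_set_sub s x : scale_set K n q s x -> K x.
Proof. by case: s => [//|s] []. Qed.

Lemma anchorP s i : active s i ->
  scale_set K n q s (anchor s i) /\ `|anchor s i - center s i| < h s.
Proof. exact: xgetPex. Qed.

Lemma h_le s : 4 * h s = tau (q * s).
Proof. by rewrite /cell_exp exprD; field. Qed.

Lemma h_le_tau s : 4 * h s <= tau s.
Proof. by rewrite h_le ler_tau// leq_pmull. Qed.

Lemma h_gt0 s : 0 < h s. Proof. exact: tau_gt0. Qed.

Lemma hS s : h s.+1 <= h s.
Proof. by rewrite ler_tau// /cell_exp leq_add2r leq_mul2l leqnSn orbT. Qed.

(** If the cell held more than [n.+1] points of [K], each would be crowded, since its window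
    contains the cell; the cell would then be active. *)
Lemma sparse_nodesP s i : ~ active s.+1 i ->
  [/\ uniq (sparse_nodes s.+1 i), (size (sparse_nodes s.+1 i) <= n.+1)%N &
    forall z, z \in sparse_nodes s.+1 i <-> K z /\ `|z - center s.+1 i| < h s.+1].
Proof.
move=> nact; rewrite /sparse_nodes; set S := [set t : seq R | _].
suff /(xgetPex [::]) : exists t, S t by [].
pose Z := [set z | K z /\ `|z - center s.+1 i| < h s.+1].
have [[z0 [Kz0 z0h]]|Z0] := pselect (exists z, Z z); last first.
  exists [::]; split=> // z; split=> // Zz.
  by case: Z0; exists z.
have Zn : Z #<= `I_n.+1.
  apply: contrapT => /negP Zn; apply: nact; exists z0; split=> //; split=> //.
  move: Zn; rewrite /crowded; apply: contraNN; apply: card_le_trans.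
  apply: subset_card_le => z [Kz zh]; split=> //=; rewrite in_itv/=.
  rewrite -h_le; move: zh z0h; rewrite !ltr_distl => /andP[? ?] /andP[? ?].
  by have h0 := h_gt0 s.+1; apply/andP; split; lra.
have [t [ut st Zt]] := card_le_seq Zn; exists t; split=> // z.
by have -> : (z \in t : Prop) = Z z by rewrite Zt.
Qed.

Lemma phi_smooth s i : smoothf (phi s i).
Proof. exact: cutoff_smooth. Qed.

Lemma correction_linear s l i : linear_map (correction s l i).
Proof.
move=> a f g; rewrite /correction !P_linear; case: ifP => _.
  by rewrite scalerBr opprD addrACA.
rewrite -interp_linear; congr interp; apply/funext => y.
have E (u v : R -> R) : (u - v) y = u y - v y by [].
have E' (u v : R -> R) : (a *: u + v) y = a * u y + v y by [].
by rewrite !(E, E') hornerD hornerZ; ring.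
Qed.

Lemma correction_depends s l i : depends_on K (correction s l i).
Proof.
move=> f g fg; rewrite /correction !(@P_depends _ _ f g fg); case: asboolP => // nact.
have [_ _ tP] := sparse_nodesP nact.
by apply: eq_interp => y /tP[Ky _]; have E (u v : R -> R) : (u - v) y = u y - v y by [];
  rewrite !E fg.
Qed.

Lemma increment_linear s : linear_map (increment s).
Proof.
move=> a f g; rewrite /increment scaler_sumr -big_split/=; apply: eq_bigr => l _.
rewrite scaler_sumr -big_split/=; apply: eq_bigr => i _; apply/funext => y.
rewrite correction_linear.
have E (u v : R -> R) : (u * v) y = u y * v y by [].
have E' (u v : R -> R) : (a *: u + v) y = a * u y + v y by [].
by rewrite !(E, E') hornerD hornerZ; ring.
Qed.

Lemma increment_depends s : depends_on K (increment s).
Proof.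
move=> f g fg; apply: eq_bigr => l _; apply: eq_bigr => i _.
by rewrite (@correction_depends s l i f g fg).
Qed.

Lemma term_smooth s l i f :
  smoothf ((phi s l * phi s.+1 i) * horner (correction s l i f)).
Proof.
by apply: smoothM; [apply: smoothM; exact: phi_smooth|exact: smooth_horner].
Qed.

Lemma increment_smooth s f : smoothf (increment s f).
Proof.
by apply: smooth_sum => l _; apply: smooth_sum => i _; exact: term_smooth.
Qed.

Lemma P_approx_uniform J N : exists M C : nat,
  forall (j s : nat) (x : R) (F : R -> R) (B y : R), (j <= J)%N -> scale_set K n q s x ->
  smoothf F -> 0 <= B -> locally_bounded_by F 0 A%:R M B -> `|y - x| <= tau s ->
  `|derive1n j F y - ((P s x F)^`(j)).[y]| <= 2 ^+ C * tau (s * N) * B.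
Proof.
have /choice[MC MCP] : forall j, exists MC : nat * nat,
    forall (s : nat) (x : R) (F : R -> R) (B y : R), scale_set K n q s x ->
    smoothf F -> 0 <= B -> locally_bounded_by F x 3 MC.1 B ->
    (forall a, K a -> `|F a| <= B) -> `|y - x| <= tau s ->
    `|derive1n j F y - ((P s x F)^`(j)).[y]| <= 2 ^+ MC.2 * tau (s * N) * B.
  by move=> j; have [M [C MC]] := P_approx j N; exists (M, C).
exists (\max_(j < J.+1) (MC j).1)%N, (\max_(j < J.+1) (MC j).2)%N.
move=> j s x F B y jJ As sF B0 FB yx.
have Kx := scale_set_sub As.
have jJ' : (j < J.+1)%N by [].
have FK a : K a -> `|F a| <= B.
  by move=> /K_bounded Ka; apply: (FB 0%N) => //; rewrite subr0; lra.
have FM : locally_bounded_by F x 3 (MC j).1 B.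
  apply: locally_bounded_byW FB; first exact: (leq_bigmax (Ordinal jJ')).
  by rewrite subr0; have := K_bounded Kx; lra.
rewrite (le_trans (MCP j s x F B y As sF B0 FM FK yx))//.
rewrite ler_wpM2r// ler_wpM2r ?(ltW (tau_gt0 _ _))// ler_weXn2l ?ler1n//.
exact: (leq_bigmax (Ordinal jJ')).
Qed.

(** In an active cell both polynomials are close to [F]. In an inactive one the error is
    interpolated at no more than [n.+1] nodes, which by Rolle is controlled by its derivatives up to
    order [n]; hence the maximum of [J] and [n]. *)
Lemma correction_bound J N : exists M C : nat,
  forall (j s l i : nat) (F : R -> R) (B y : R), (j <= J)%N -> active s l ->
  smoothf F -> 0 <= B -> locally_bounded_by F 0 A%:R M B ->
  `|y - center s l| <= h s -> `|y - center s.+1 i| <= h s.+1 ->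
  `|((correction s l i F)^`(j)).[y]| <= 2 ^+ C * tau (s * N) * B.
Proof.
have [M [C MCP]] := P_approx_uniform (maxn J n) N.
(* The exponent [2 * n.+1] pays for the [4 ^+ n.+1] of the interpolation bound, the successor for
   the sum of two errors. *)
exists M, (C + (2 * n.+1).+1)%N => j s l i F B y jJ actl sF B0 FB yl yi.
have [Al Ald] := anchorP actl.
have h0 := h_gt0 s.+1; have hh := hS s; have h4 := h_le_tau s.
have X0 : 0 <= 2 ^+ C * tau (s * N) * B.
  by rewrite !mulr_ge0// ?exprn_ge0// ltW// tau_gt0.
have jJn : (j <= maxn J n)%N by rewrite leq_max jJ.
have yal : `|y - anchor s l| <= tau s.
  by move: yl Ald; rewrite ler_distl ltr_distl ler_distl => /andP[? ?] /andP[? ?];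
    apply/andP; split; lra.
have -> : 2 ^+ (C + (2 * n.+1).+1) * tau (s * N) * B =
    4 ^+ n.+1 * (2 ^+ C * tau (s * N) * B) * 2.
  by rewrite exprD exprS exprM (_ : 2 ^+ 2 = 4); ring.
have one4 : 1 <= 4 ^+ n.+1 :> R by rewrite exprn_ege1// ler1n.
set X := 2 ^+ C * tau (s * N) * B in X0 *.
have X4 : X <= 4 ^+ n.+1 * X by rewrite ler_peMl.
rewrite /correction; case: asboolP => [acti|nact].
  have [Ai Aid] := anchorP acti; have h4' := h_le_tau s.+1.
  have yai : `|y - anchor s.+1 i| <= tau s.+1.
    by move: yi Aid; rewrite ler_distl ltr_distl ler_distl => /andP[? ?] /andP[? ?];
      apply/andP; split; lra.
  have H1 := MCP j s _ F B y jJn Al sF B0 FB yal.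
  have H2 := MCP j s.+1 _ F B y jJn Ai sF B0 FB yai.
  have H3 : 2 ^+ C * tau (s.+1 * N) * B <= X.
    by rewrite /X ler_wpM2r// ler_wpM2l ?exprn_ge0// ler_tau// leq_mul2r leqnSn orbT.
  rewrite derivnB hornerD hornerN; set d := derive1n j F y in H1 H2.
  set p := _.[y]; set p' := _.[y].
  have -> : p - p' = (d - p') - (d - p) by ring.
  apply: (le_trans (ler_normB _ _)); apply: (le_trans (lerD H1 H2)).
  rewrite -/X; lra.
have [ut st tP] := sparse_nodesP nact.
pose G := F - horner (P s (anchor s l) F).
have sG : smoothf G by apply: smoothB => //; exact: smooth_horner.
have := @interp_derivn_bound R G (sparse_nodes s.+1 i) (anchor s l) (tau s) X j y sG ut X0.
rewrite tau_le1 (ltW (tau_gt0 _ _)) => /(_ isT) H.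
apply: (le_trans (H _ _ yal)).
- move=> a /tP[_ ai]; move: yl yi Ald ai; rewrite !ler_distl !ltr_distl.
  move=> /andP[? ?] /andP[? ?] /andP[? ?] /andP[? ?].
  by apply/andP; split; lra.
- move=> k w kt wa.
  have kn : (k <= maxn J n)%N by rewrite leq_max orbC -ltnS (leq_trans kt).
  rewrite derive1nB ?derive1n_horner//; last exact: smooth_horner.
  exact: MCP.
have : 4 ^+ size (sparse_nodes s.+1 i) * X <= 4 ^+ n.+1 * X.
  by rewrite ler_wpM2r// ler_weXn2l ?ler1n.
by lra.
Qed.

Lemma phi_bound J : exists b : nat, forall j s i y, (j <= J)%N ->
  `|derive1n j (phi s i) y| <= 2 ^+ (cell_exp q s * J + b).
Proof.
have /choice[B BP] := theta_bounded.
have [b bP] := pow2_unbounded (\sum_(j < J.+1) B j).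
exists b => j s i y jJ; have [Bj Bjt] := BP j.
rewrite (le_trans (cutoff_derive_bound q A theta_smooth s i y Bjt))// exprD ler_pM//.
  by rewrite ler_weXn2l ?ler1n// leq_mul2l jJ orbT.
rewrite (le_trans _ (ltW bP))// (bigD1 (Ordinal (jJ : (j < J.+1)%N)))//= lerDl.
by apply: sumr_ge0 => k _; have [] := BP k.
Qed.

Lemma grid_size_le s : (grid_size q A s)%:R <= 2 ^+ (A.*2 + cell_exp q s) :> R.
Proof.
rewrite -natrX ler_nat expnD /grid_size -addn1.
apply: (@leq_trans ((A.*2).+1 * 2 ^ cell_exp q s)); last first.
  by rewrite leq_mul2r ltn_expl// orbT.
by rewrite mulSn addnC leq_add2r expn_gt0.
Qed.

Lemma increment_arith s j b C :
  (A.*2 + cell_exp q s + (A.*2 + cell_exp q s.+1) +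
    (j + (j + (cell_exp q s * j + b + (cell_exp q s.+1 * j + b)) + C)) + s <=
   s * (2 * q * j.+1).+1 + (A.*2 + A.*2 + j + j + b + b + C + (q + 4) * j.+1))%N.
Proof. by rewrite /cell_exp; nia. Qed.

(** The numbers of cells at the two scales and the derivatives of the cutoffs together cost
    [2^(2 q (j+1) s)] up to constants. Corrections of order one higher leave the factor [2^-s]
    needed for summation. *)
Lemma increment_bound j : exists M C : nat, forall (F : R -> R) (B : R) s y,
  smoothf F -> 0 <= B -> locally_bounded_by F 0 A%:R M B ->
  `|derive1n j (increment s F) y| <= 2 ^+ C * tau s * B.
Proof.
have [b bP] := phi_bound j.
have [M [C MCP]] := correction_bound j (2 * q * j.+1).+1.
exists M, (A.*2 + A.*2 + j + j + b + b + C + (q + 4) * j.+1)%N => F B s y sF B0 FB.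
set X := 2 ^+ (j + (j + (cell_exp q s * j + b + (cell_exp q s.+1 * j + b)) + C)) *
  tau (s * (2 * q * j.+1).+1) * B.
have X0 : 0 <= X by rewrite !mulr_ge0// ?exprn_ge0// ltW// tau_gt0.
have term l i : active s l ->
    `|derive1n j ((phi s l * phi s.+1 i) * horner (correction s l i F)) y| <= X.
  move=> actl; have sl := phi_smooth s l; have si := phi_smooth s.+1 i.
  have sh := smooth_horner (correction s l i F).
  have [yl|yl] := leP `|y - center s l| (h s); last first.
    rewrite derive1nM_eq0 ?normr0//; first exact: smoothM.
    by move=> k kj; apply: derive1nM_eq0 => // k' _; exact: cutoff_derive_supp.
  have [yi|yi] := leP `|y - center s.+1 i| (h s.+1); last first.
    rewrite derive1nM_eq0 ?normr0//; first exact: smoothM.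
    by move=> k kj; rewrite mulrC; apply: derive1nM_eq0 => // k' _; exact: cutoff_derive_supp.
  have H := @derive1nM_bound R (phi s l * phi s.+1 i) (horner (correction s l i F)) y
    (2 ^+ (j + (cell_exp q s * j + b + (cell_exp q s.+1 * j + b))))
    (2 ^+ C * tau (s * (2 * q * j.+1).+1) * B) j (smoothM sl si) sh.
  apply: (le_trans (H _ _)).
  - move=> k kj.
    have H' := @derive1nM_bound R (phi s l) (phi s.+1 i) y
      (2 ^+ (cell_exp q s * j + b)) (2 ^+ (cell_exp q s.+1 * j + b)) k sl si.
    apply: (le_trans (H' _ _)).
    + by move=> k' kk'; apply: bP; exact: leq_trans kj.
    + by move=> k' kk'; apply: bP; exact: leq_trans kj.
    by rewrite -!exprD ler_weXn2l ?ler1n// leq_add2r.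
  - by move=> k kj; rewrite derive1n_horner; exact: MCP.
  by rewrite /X !mulrA -!exprD !addnA.
rewrite /increment derive1n_sum => [|l _]; last by apply: smooth_sum => i _; exact: term_smooth.
rewrite fct_sumE (le_trans (ler_norm_sum _ _ _))//.
apply: (@le_trans _ _ (\sum_(l < grid_size q A s) \sum_(i < grid_size q A s.+1) X)).
  rewrite big_mkcond/=; apply: ler_sum => l _; case: asboolP => [actl|_]; last first.
    by apply: sumr_ge0.
  rewrite derive1n_sum => [|i _]; last exact: term_smooth.
  rewrite fct_sumE (le_trans (ler_norm_sum _ _ _))//.
  by apply: ler_sum => i _; exact: term.
rewrite !sumr_const !card_ord -[leLHS]mulr_natl -[X *+ _]mulr_natl mulrA.
rewrite (le_trans (ler_wpM2r X0 (ler_pM (ler0n _ _) (ler0n _ _) (grid_size_le _) (grid_size_le _))))//.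
rewrite /X !mulrA -!exprD ler_wpM2r//; apply: ler_pow2_tau.
exact: increment_arith.
Qed.

(** * Telescoping on [K] *)

Lemma phi_sum s x : K x -> \sum_(i < grid_size q A s) phi s i x = 1.
Proof. by move=> /K_bounded Kx; apply: cutoff_sum => //; lra. Qed.

Lemma phi_active s i x : scale_set K n q s x -> phi s i x != 0 -> active s i.
Proof.
move=> Ax; have [//|nact] := pselect (active s i).
suff -> : phi s i x = 0 by rewrite eqxx.
apply: cutoff_supp => //; rewrite leNgt; apply/negP => xi; apply: nact.
by exists x.
Qed.

Lemma phi_active_sum s x : scale_set K n q s x ->
  \sum_(i < grid_size q A s | `[< active s i >]) phi s i x = 1.
Proof.
move=> Ax; rewrite -(phi_sum s (scale_set_sub Ax)) [RHS](bigID (fun i => `[< active s (nat_of_ord i) >]))/=.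
rewrite [X in _ + X]big1 ?addr0// => i nact; apply/eqP; apply: contraNT nact => xi.
by apply/asboolP; exact: phi_active xi.
Qed.

(** The cell contains a crowded point [z] near [x]. The window of [x] at the coarser scale is at
    least twice as wide as that of [z] and contains it. *)
Lemma scale_set_pred s i x : K x -> active s.+1 i -> phi s.+1 i x != 0 ->
  scale_set K n q s x.
Proof.
move=> Kx [z [[Kz cz] zi]] xi; case: s => [//|s] in cz zi xi *; split=> //.
have xc : `|x - center s.+2 i| < h s.+2.
  by rewrite ltNge; apply: contraNN xi => xi; apply/eqP; exact: cutoff_supp.
have h0 := h_gt0 s.+2; have hE := h_le s.+2.
have h2 : 2 * tau (q * s.+2) <= tau (q * s.+1) :> R.
  by rewrite -{1}[2]expr1; apply: (@le_trans _ _ (2 ^+ 0 * tau (q * s.+1)));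
    [apply: ler_pow2_tau; nia|rewrite mul1r].
apply: crowdedS cz; move: zi xc; rewrite !ltr_distl => /andP[? ?] /andP[? ?]; lra.
Qed.

(** Sum over the finer cells first: active ones replace the coarse error by the finer one, inactive
    ones reproduce it exactly at [x], so each coarse error loses [Y], the next defect. The active
    coarse cutoffs multiplying [Y] sum to 1 unless [Y] is 0. *)
Lemma increment_defect s f x : K x -> increment s f x = defect s f x - defect s.+1 f x.
Proof.
move=> Kx; rewrite /increment fct_sumE.
pose Y := defect s.+1 f x.
have E (u v : R -> R) : (u * v) x = u x * v x by [].
have E' (u v : R -> R) : (u - v) x = u x - v x by [].
transitivity (\sum_(l < grid_size q A s | `[< active s l >])
    phi s l x * (f x - (P s (anchor s l) f).[x] - Y)).
  apply: eq_bigr => l _; rewrite fct_sumE.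
  under eq_bigr do rewrite !E -mulrA.
  rewrite -mulr_sumr; congr (_ * _).
  rewrite -[X in X - Y]mul1r -(phi_sum s.+1 Kx) mulr_suml.
  rewrite /Y /defect [X in _ - X]big_mkcond/= -sumrB; apply: eq_bigr => i _.
  rewrite /correction; case: asboolP => [acti|nact].
    by rewrite hornerD hornerN; ring.
  rewrite subr0; have [->|xi] := eqVneq (phi s.+1 i x) 0; first by rewrite !mul0r.
  have [ut _ tP] := sparse_nodesP nact.
  rewrite interp_horner ?E'//; apply/tP; split=> //.
  by rewrite ltNge; apply: contraNN xi => xi; apply/eqP; exact: cutoff_supp.
under eq_bigr do rewrite mulrBr.
rewrite sumrB -mulr_suml; congr (_ - _).
have [Y0|Y0] := eqVneq Y 0; first by rewrite -/Y Y0 mulr0.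
rewrite phi_active_sum ?mul1r//.
have [[i [acti xi]]|nex] := pselect (exists i, active s.+1 i /\ phi s.+1 i x != 0).
  exact: scale_set_pred xi.
case/eqP: Y0; rewrite /Y /defect big1// => i /asboolP acti.
have [->|xi] := eqVneq (phi s.+1 i x) 0; first by rewrite mul0r.
by case: nex; exists i.
Qed.

Lemma defect0 f x : K x -> defect 0 f x = f x.
Proof.
move=> Kx; rewrite /defect; under eq_bigr do rewrite P_0 horner0 subr0.
by rewrite -mulr_suml phi_active_sum// mul1r.
Qed.

Lemma defect_bound (F : R -> R) x : smoothf F -> K x ->
  exists D, forall s, `|defect s F x| <= D * tau s.
Proof.
move=> sF Kx; have [b bP] := phi_bound 0.
(* Of these [q.+1] orders, [q] pay for the number of cells at scale [s] and one leaves [2^-s]. *)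
have [M [C MCP]] := P_approx_uniform 0 q.+1.
have [B [B0 FB]] := smooth_locally_bounded 0 A%:R M sF.
exists (2 ^+ (A.*2 + 2 + b + C) * B) => s.
set X := 2 ^+ (b + C) * tau (s * q.+1) * B.
have X0 : 0 <= X by rewrite !mulr_ge0// ?exprn_ge0// ltW// tau_gt0.
rewrite /defect (le_trans (ler_norm_sum _ _ _))//.
apply: (@le_trans _ _ (\sum_(l < grid_size q A s) X)).
  rewrite big_mkcond/=; apply: ler_sum => l _; case: asboolP => [actl|//].
  have [xl|xl] := leP (h s) `|x - center s l|.
    by rewrite cutoff_supp// mul0r normr0.
  have [Al Ald] := anchorP actl; have h4 := h_le_tau s; have h0 := h_gt0 s.
  rewrite normrM /X exprD -!mulrA ler_pM//.
    by have := bP 0%N s l x isT; rewrite muln0 add0n.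
  have := MCP 0%N s (anchor s l) F B x isT Al sF B0 FB.
  rewrite derivn0 -mulrA; apply.
  move: xl Ald; rewrite !ltr_distl ler_distl => /andP[? ?] /andP[? ?].
  by apply/andP; split; lra.
rewrite sumr_const card_ord -[leLHS]mulr_natl (le_trans (ler_wpM2r X0 (grid_size_le _)))//.
rewrite /X !mulrA -!exprD [_ * B * _]mulrAC ler_wpM2r//; apply: ler_pow2_tau.
by rewrite /cell_exp; nia.
Qed.

Lemma increment_cvg (F : R -> R) x : smoothf F -> K x ->
  limn (series (fun s => increment s F x)) = F x.
Proof.
move=> sF Kx; have [D DP] := defect_bound sF Kx.
have serE m : series (fun s => increment s F x) m = F x - defect m F x.
  elim: m => [|m IHm]; first by rewrite /series/= big_nil defect0// subrr.
  by rewrite seriesSr IHm increment_defect//; ring.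
apply/cvg_lim => //; apply/cvgrPdist_le => e e0.
have h1 : `|2^-1 : R| < 1 by rewrite ger0_norm ?invr_ge0// invf_lt1// ltr1n.
have /cvgrPdist_le /(_ e e0) := cvg_geometric D h1.
apply: filterS => m; rewrite sub0r normrN => De.
rewrite serE opprB addrC subrK (le_trans (DP m))// (le_trans _ De)//.
exact: ler_norm.
Qed.

(** * The sum of all increments *)

Definition glue (f : R -> R) : R -> R := derive_series (fun s => increment s f) 0.

Lemma increment_summable F : smoothf F ->
  exists C : nat -> R, forall j s y, `|derive1n j (increment s F) y| <= C j * tau s.
Proof.
move=> sF; suff /choice[C CP] : forall j, exists C : R, forall s y,
    `|derive1n j (increment s F) y| <= C * tau s by exists C.
move=> j; have [M [C MCP]] := increment_bound j.
have [B [B0 FB]] := smooth_locally_bounded 0 A%:R M sF.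
by exists (2 ^+ C * B) => s y; rewrite mulrAC; exact: MCP.
Qed.

Lemma glue_smooth F : smoothf F -> smoothf (glue F).
Proof.
move=> sF; have [C CP] := increment_summable sF.
by apply: smooth_series_sum CP => s; exact: increment_smooth.
Qed.

Lemma glueE F x : smoothf F -> K x -> glue F x = F x.
Proof. exact: increment_cvg. Qed.

Lemma glue_depends : depends_on K glue.
Proof.
move=> f g fg; rewrite /glue; congr derive_series.
by apply/funext => s; exact: increment_depends.
Qed.

Lemma glue_linear (a : R) F G : smoothf F -> smoothf G ->
  glue (a *: F + G) = a *: glue F + glue G.
Proof.
move=> sF sG; apply/funext => y.
have [C CP] := increment_summable sF; have [C' CP'] := increment_summable sG.
have cF := @derive_series_cvg _ _ _ CP y; have cG := @derive_series_cvg _ _ _ CP' y.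
pose u s := increment s F y; pose v s := increment s G y.
transitivity (limn (series (a *: u + v))).
  congr (limn (series _)); apply/funext => s.
  exact: (congr1 (fun f => f y) (increment_linear s a F G)).
rewrite lim_seriesD//; last exact: is_cvg_seriesZ.
by rewrite lim_seriesZ.
Qed.

Lemma glue_bound j : exists M C : nat, forall (F : R -> R) (B : R) y,
  smoothf F -> 0 <= B -> locally_bounded_by F 0 A%:R M B ->
  `|derive1n j (glue F) y| <= 2 ^+ C * B.
Proof.
have [M [C MCP]] := increment_bound j.
exists M, C.+1 => F B y sF B0 FB; have [C' CP'] := increment_summable sF.
(* Summability at other orders may depend on [F] through [C']; only the entry at order [j] has to be
   uniform. *)
pose D i := if i == j then 2 ^+ C * B else C' i.
have DP i s z : `|derive1n i (increment s F) z| <= D i * tau s.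
  rewrite /D; case: eqVneq => [->|_]; last exact: CP'.
  by rewrite mulrAC; exact: MCP.
rewrite (le_trans (derive_series_bound _ DP j y))//.
  by move=> s; exact: increment_smooth.
by rewrite /D eqxx exprS mulrA.
Qed.

End gluing.

(** * Topology *)

Section smooth_topology.
Variable R : realType.
Implicit Types (F : smooth R).

Lemma nbhs_smooth F0 (j : nat) (A d : R) : 0 < d ->
  nbhs F0 [set F : smooth R | forall w, `|w| <= A -> `|derive1n j F w - derive1n j F0 w| < d].
Proof.
move=> d0.
have cd : {for F0, continuous (@derivatives R)} by exact: initial_continuous.
have cj := @proj_continuous nat (fun=> {family compact, R -> R}) j (derivatives F0).
have cdj : derivatives F j @[F --> F0] --> (derivatives F0 j : {family compact, R -> R}).
  exact: cvg_comp cd cj.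
have H : forall C : set R, compact C ->
    {uniform C, derivatives F j @[F --> F0] --> (derivatives F0 j : R -> R)}.
  by apply/fam_cvgP; [exact: (fmap_filter _ (nbhs_filter F0))|exact: cdj].
have := H `[- A, A]%classic (@segment_compact _ _ _).
move=> /(_ [set h : R -> R | forall w, `|w| <= A -> `|h w - derive1n j F0 w| < d]); apply.
apply/uniform_nbhs.
have e := entourage_ball R (PosNum d0).
exists [set xy | ball xy.1 d xy.2]; split; first exact: e.
move=> g /= gP w wA; rewrite distrC; apply: gP.
by rewrite /= in_itv/= -ler_norml.
Qed.

Lemma cvg_smooth (X : set_system (smooth R)) F0 : Filter X ->
  (forall (j : nat) (A d : R), 0 < d -> X [set F : smooth R |
    forall w, `|w| <= A -> `|derive1n j F w - derive1n j F0 w| < d]) ->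
  X --> F0.
Proof.
move=> FX XP U [? [[W oW <-]] WF0 /filterS]; apply.
have cX : (@derivatives R @ X) --> derivatives F0.
  apply/cvg_sup => j V [? [[Z oZ <-]] ZF0 /filterS]; apply.
  have cj : derivatives F j @[F --> X] --> (derivatives F0 j : {family compact, R -> R}).
    apply/fam_cvgP => C /compact_bounded [A [_ AC]] Q /uniform_nbhs[E [entE EQ]].
    move: entE; rewrite -entourage_ballE => -[d /= d0 dE].
    suff : X [set F : smooth R | Q (derivatives F j)] by [].
    apply: (filterS _ (XP j (A + 1) d d0)) => F FP; apply: EQ => w Cw.
    apply: (dE (derivatives F0 j w, derivatives F j w)).
    rewrite /ball/= distrC; apply: FP.
    by apply: AC => //; rewrite ltrDl.
  exact: (cj Z (open_nbhs_nbhs (conj oZ ZF0))).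
exact: (cX W (open_nbhs_nbhs (conj oW WF0))).
Qed.

End smooth_topology.

(** Carrying the proof of linearity as an argument lets the linear structure be inferred from the
    term. *)
Definition linear_fun_of (R : pzRingType) (U V : lmodType R) (f : U -> V)
  (_ : linear f) : U -> V := f.

HB.instance Definition _ (R : pzRingType) (U V : lmodType R) (f : U -> V)
    (lf : linear f) :=
  GRing.isLinear.Build R U V *:%R (linear_fun_of lf) lf.

(** * From an operator on smooth functions to one on the quotient *)

Section extension_operator.
Variables (R : realType) (K : set R) (A : R) (G : (R -> R) -> R -> R).
Hypothesis G_smooth : forall F, smoothf F -> smoothf (G F).
Hypothesis GE : forall F x, smoothf F -> K x -> G F x = F x.
Hypothesis G_depends : depends_on K G.
Hypothesis G_linear : forall (a : R) F F', smoothf F -> smoothf F' ->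
  G (a *: F + F') = a *: G F + G F'.
Hypothesis G_bound : forall j, exists M C : nat, forall (F : R -> R) (B : R) y,
  smoothf F -> 0 <= B -> locally_bounded_by F 0 A M B ->
  `|derive1n j (G F) y| <= 2 ^+ C * B.

Let smooth_smoothf (F : smooth R) : smoothf F.
Proof. by split; exact: smooth_funP. Qed.

Let is_smooth_G (F : smooth R) : G F \in is_smooth R.
Proof. by have [] := G_smooth (smooth_smoothf F). Qed.

Let G_op (F : smooth R) : smooth R := Smooth (is_smooth_G F).

Let lift_subproof (f : smooth_on K) : exists F : smooth R, sigL K F = f.
Proof. exact/asboolP/smooth_on_funP. Qed.

(** An arbitrary choice of extensions, with no claim of linearity or continuity; both come from [G],
    which sees only the values on [K]. *)
Let lift (f : smooth_on K) : smooth R := projT1 (cid (lift_subproof f)).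

Let liftP f : sigL K (lift f) = f.
Proof. exact: projT2 (cid (lift_subproof f)). Qed.

Let sigL_eq (u v : R -> R) : sigL K u = sigL K v -> forall x, K x -> u x = v x.
Proof.
move=> uv x Kx; have := congr1 (fun w => w (SigSub (mem_set Kx))) uv.
by [].
Qed.

Let G_op_lift (F : smooth R) : G_op (lift (restr K F)) = G_op F.
Proof.
apply/val_inj; apply: G_depends; apply: sigL_eq.
exact: liftP.
Qed.

Let E (f : smooth_on K) : smooth R := G_op (lift f).

Let E_linear : linear E.
Proof.
move=> a f g; apply/val_inj => /=.
have -> : G (lift (a *: f + g)) = G (a *: (lift f : R -> R) + lift g).
  apply: G_depends; apply: sigL_eq; rewrite liftP.
  have -> : sigL K (a *: (lift f : R -> R) + lift g) = a *: sigL K (lift f) + sigL K (lift g) by [].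
  by rewrite !liftP.
by rewrite G_linear//; exact: smooth_smoothf.
Qed.

(** Continuity on a quotient is tested after composition with [restr K], and there the choice in
    [lift] disappears. What remains is linear in [F], so [G_bound] applied to [F - F0] suffices. *)
Let E_restr_continuous : continuous (E \o restr K).
Proof.
have -> : E \o restr K = G_op by apply/funext => F; exact: G_op_lift.
move=> F0; apply: cvg_smooth; first exact: (fmap_filter _ (nbhs_filter F0)).
move=> j r d d0.
have [M [C MCP]] := G_bound j.
(* The exponent [C.+1] instead of [C] turns the weak inequality of [G_bound] into a strict one. *)
have e0 : 0 < d / 2 ^+ C.+1 by rewrite divr_gt0// exprn_gt0.
have near_bounded : nbhs F0 [set F : smooth R |
    locally_bounded_by (F - F0 : R -> R) 0 A M (d / 2 ^+ C.+1)].
  have : \forall F \near nbhs F0, forall i : 'I_M.+1, [set F : smooth R | forall w, `|w| <= A ->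
      `|derive1n i F w - derive1n i F0 w| < d / 2 ^+ C.+1] F.
    by apply: filter_forall => i; exact: nbhs_smooth.
  apply: filterS => F FP i w iM; rewrite subr0 => wA.
  rewrite derive1nB; [|exact: smooth_smoothf..].
  apply/ltW.
  exact: (FP (Ordinal (iM : (i < M.+1)%N))).
apply: filterS near_bounded => F FB w _.
rewrite /=.
have -> : derive1n j (G F) w - derive1n j (G F0) w = derive1n j (G (F - F0 : R -> R)) w.
  have -> : (F - F0 : R -> R) = (-1) *: (F0 : R -> R) + F by rewrite scaleN1r addrC.
  rewrite G_linear; [|exact: smooth_smoothf..].
  rewrite [_ *: _ + _]addrC scaleN1r derive1nB//; exact/G_smooth/smooth_smoothf.
have sD : smoothf (F - F0 : R -> R) by apply: smoothB; exact: smooth_smoothf.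
rewrite (le_lt_trans (MCP _ _ _ sD (ltW e0) FB))//.
rewrite mulrA ltr_pdivrMr ?exprn_gt0// mulrC ltr_pM2l// ltr_eXn2l//.
by rewrite ltr1n.
Qed.

Lemma extension_property_of_operator : smooth_extension_property K.
Proof.
exists (linear_fun_of E_linear); split.
  apply/continuousP => U oU; rewrite /linear_fun_of.
  have -> : open (E @^-1` U) = open ((E \o restr K) @^-1` U) by [].
  by move/continuousP : E_restr_continuous; exact.
move=> f; apply/val_inj/funext => x /=.
rewrite -[in RHS](liftP f); apply: GE; [exact: smooth_smoothf|exact: set_valP].
Qed.

End extension_operator.

Theorem theorem3p2 (R : realType) (K : set R) (n : nat) :
  compact K ->
  (exists r gamma : R, [/\ 1 <= r, 1 <= gamma &
    forall m k : nat, (m <= k)%N ->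
    exists c eps_k : R, [/\ 0 < c, 0 < eps_k &
    forall eps x : R, 0 < eps < eps_k -> K x ->
    ~~ (K `&` `]x - eps `^ r, x + eps `^ r[ #<= `I_n.+1) ->
    exists y : 'I_k.+1 -> R,
      [/\ injective y,
          forall i, (K `&` `]x - eps, x + eps[) (y i) &
          sup [set `|y i - y v| | i in [set: 'I_k.+1] & v in [set: 'I_k.+1]] ^+ (k - m)
          / inf [set z | exists i v : 'I_k.+1, i != v /\ z = `|y i - y v|] ^+ k
          <= c / eps `^ (gamma * m%:R)]]]) ->
  smooth_extension_property K.
Proof.
move=> /compact_bounded[A0 [_ KA0]] /node_condition_of_powR[q [g [q0 HK]]].
have [P [P_lin P_dep P_0 P_est]] := approximants HK.
have [theta [ts tsupp tsum tb]] := smooth_bump R.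
(* The 1 is there because [K] is bounded by every number above [A0]; the 4 leaves room for the balls
   of radius 3 around points of [K]. *)
pose A := (Num.truncn (A0 + 1 + 4)).+1.
have KA x : K x -> `|x| + 4 <= A%:R.
  move=> Kx; have xA : `|x| <= A0 + 1 by apply: KA0 => //; rewrite ltrDl.
  by rewrite (le_trans _ (ltW (truncnS_gt _)))// lerD2r.
apply: (@extension_property_of_operator R K A%:R (glue K n q A theta P)).
- by apply: glue_smooth.
- by apply: glueE.
- by apply: glue_depends.
- by apply: glue_linear.
- by apply: glue_bound.
Qed.
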